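(* Let $\rho$ be a density operator of a two-qubit system with concurrence $C=C(\rho)$. Then $$\mathcal{N}(\rho)\le 2\sqrt{1+C^2},$$ with equality if and only if $\rho\in\mathcal{Q}$, where $$\mathcal{Q}=\{(U_A\otimes U_B)\big(p|\varphi_1\rangle\langle\varphi_1|+(1-p)|\varphi_2\rangle\langle\varphi_2|\big)(U_A\otimes U_B)^\dagger\},$$ with $U_A,U_B$ ranging over unitaries on $\mathbb{C}^2$, $p\in[0,1]$, $|\varphi_1\rangle=\cos\theta|00\rangle+\sin\theta|11\rangle$ and $|\varphi_2\rangle=\sin\theta|00\rangle+\cos\theta|11\rangle$ for some $\theta\in[0,\pi)$.
   Context: $\sigma_1,\sigma_2,\sigma_3$ (also $X,Y,Z$) are the Pauli matrices. A CHSH operator is an operator $S=A\otimes(B+B')+A'\otimes(B-B')$ with $A=\vec a\cdot\vec\sigma$, $A'=\vec a'\cdot\vec\sigma$, $B=\vec b\cdot\vec\sigma$, $B'=\vec b'\cdot\vec\sigma$ for unit vectors $\vec a,\vec a',\vec b,\vec b'\in\mathbb{R}^3$; the nonlocality of a two-qubit state $\rho$ is $\mathcal{N}(\rho)=\max_S\mathrm{tr}(\rho S)$ over all CHSH operators. The concurrence (Wootters) of a two-qubit density operator $\rho$ is $C(\rho)=\max\{0,\lambda_1-\lambda_2-\lambda_3-\lambda_4\}$, where $\lambda_1\ge\lambda_2\ge\lambda_3\ge\lambda_4$ are the eigenvalues of $\sqrt{\sqrt\rho\,\tilde\rho\,\sqrt\rho}$ with $\tilde\rho=(Y\otimes Y)\rho^*(Y\otimes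 Y)$ ($\rho^*$ the complex conjugate in the computational basis); for a pure state $|\psi\rangle$ it equals $|\langle\psi|(Y\otimes Y)|\psi^*\rangle|$. *)

(* Defs.v *)
(* R : realType, complex numbers R[i] (mathcomp-real-closed),
   matrices over R[i], spectral.v for unitary matrices and conjugate transpose. *)
From HB Require Import structures.
From mathcomp Require Import all_boot all_algebra.
From mathcomp Require Import complex spectral.
From mathcomp Require Import boolp classical_sets reals trigo.

Set Implicit Arguments.
Unset Strict Implicit.
Unset Printing Implicit Defensive.

Import GRing.Theory Num.Theory.
Local Open Scope ring_scope.
Local Open Scope sesquilinear_scope.
Local Open Scope classical_set_scope.
Local Open Scope complex_scope.
Local Open Scope ring_scope.

Section QuantumDefs.
Variable R : realType.
Local Notation C := (R[i]).

(* Kronecker product of two 2x2 matrices, with the computational basis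
   ordered |00>, |01>, |10>, |11>  (index k <-> |k/2, k mod 2>). *)
Definition hi (k : 'I_4) : 'I_2 := inord (k %/ 2).
Definition lo (k : 'I_4) : 'I_2 := inord (k %% 2).
Definition kron (A B : 'M[C]_2) : 'M[C]_4 :=
  \matrix_(i, j) (A (hi i) (hi j) * B (lo i) (lo j)).

(* Pauli matrices sigma_1 = X, sigma_2 = Y, sigma_3 = Z. *)
Definition pauliX : 'M[C]_2 := \matrix_(i, j) (if i != j then 1 else 0).
Definition pauliY : 'M[C]_2 :=
  \matrix_(i, j) (if (i == 0) && (j == 1) then - 'i%C
                  else if (i == 1) && (j == 0) then 'i%C else 0).
Definition pauliZ : 'M[C]_2 :=
  \matrix_(i, j) (if i == j then (if i == 0 then 1 else -1) else 0).
Definition pauli (k : 'I_3) : 'M[C]_2 :=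
  if k == 0 then pauliX else if k == 1 then pauliY else pauliZ.

(* unit vectors of R^3 and the observable  v . sigma *)
Definition unit3 (v : 'rV[R]_3) : Prop := \sum_(k < 3) v 0 k ^+ 2 = 1.
Definition dot_sigma (v : 'rV[R]_3) : 'M[C]_2 :=
  \sum_(k < 3) (v 0 k)%:C *: pauli k.

(* CHSH operator S = A (x) (B + B') + A' (x) (B - B') *)
Definition chsh (a a' b b' : 'rV[R]_3) : 'M[C]_4 :=
  kron (dot_sigma a) (dot_sigma b + dot_sigma b')
  + kron (dot_sigma a') (dot_sigma b - dot_sigma b').

(* positive semidefinite (Hermitian, nonnegative expectation values);
   in the numClosedField order of R[i], 0 <= z means z real and >= 0 *)
Definition psd (M : 'M[C]_4) : Prop :=
  M ^t* = M /\ forall v : 'rV[C]_4, 0 <= (v *m M *m v ^t*) 0 0.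

(* two-qubit density operator *)
Definition density (rho : 'M[C]_4) : Prop := psd rho /\ \tr rho = 1.

(* nonlocality  N(rho) = max_S tr(rho S), S ranging over CHSH operators;
   tr(rho S) is real for Hermitian rho and S, we take its real part.  The max
   (which is attained, by compactness) is rendered as the supremum. *)
Definition chsh_values (rho : 'M[C]_4) : set R :=
  [set x | exists a a' b b' : 'rV[R]_3,
     [/\ unit3 a, unit3 a', unit3 b, unit3 b' &
         x = complex.Re (\tr (rho *m chsh a a' b b'))]].
Definition nonlocality (rho : 'M[C]_4) : R := sup (chsh_values rho).

(* spin flip  rho~ = (Y (x) Y) rho^* (Y (x) Y) *)
Definition spin_flip (rho : 'M[C]_4) : 'M[C]_4 :=
  kron pauliY pauliY *m map_mx (fun z : C => z^*%C) rho *m kron pauliY pauliY.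

(* Wootters concurrence: c = max(0, l1 - l2 - l3 - l4) where l1 >= ... >= l4
   are the eigenvalues (with multiplicity, i.e. the roots of the characteristic
   polynomial) of sqrt(sqrt rho  rho~  sqrt rho), sqrt denoting the positive
   semidefinite square root. *)
Definition concurrence_is (rho : 'M[C]_4) (c : R) : Prop :=
  exists (M N : 'M[C]_4) (l : 'I_4 -> R),
    [/\ psd M /\ M *m M = rho,
        psd N /\ N *m N = M *m spin_flip rho *m M,
        char_poly N = \prod_(k < 4) ('X - ((l k)%:C)%:P),
        (forall j k : 'I_4, (j <= k)%N -> l k <= l j) &
        c = Num.max 0 (l 0 - l 1 - l 2 - l 3)].

(* the family Q *)
Definition ket00_11 (x y : R) : 'cV[C]_4 :=
  \col_k (if (k : nat) == 0%N then x%:C else if (k : nat) == 3%N then y%:C else 0).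
Definition proj4 (v : 'cV[C]_4) : 'M[C]_4 := v *m v ^t*.

Definition inQ (rho : 'M[C]_4) : Prop :=
  exists (UA UB : 'M[C]_2) (p theta : R),
    [/\ UA \is unitarymx, UB \is unitarymx,
        0 <= p <= 1, 0 <= theta < pi &
        rho = kron UA UB
              *m (p%:C *: proj4 (ket00_11 (cos theta) (sin theta))
                  + (1 - p)%:C *: proj4 (ket00_11 (sin theta) (cos theta)))
              *m (kron UA UB) ^t*].
End QuantumDefs.

(* Main.v *)
Require Import Defs.
From HB Require Import structures.
From mathcomp Require Import all_boot all_algebra.
From mathcomp Require Import complex spectral.
From mathcomp Require Import boolp classical_sets reals trigo.
From mathcomp Require Import topology normedtype derive.
From mathcomp Require Import all_order perm ring lra zify.
Import Order.TTheory GRing.Theory Num.Theory.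
Import numFieldNormedType.Exports.
Local Open Scope ring_scope.

(** Write [T u v] for the correlation tr(rho (u.sigma (x) v.sigma)).  The CHSH
    value of [a a' b b'] is at most 2 sqrt(|T c|^2 + |T c'|^2), where [c, c'] are
    the orthonormal directions of b+b' and b-b'.  Rotating [c, c'] in their plane
    makes T c and T c' orthogonal, so a local unitary turns the two relevant
    correlations into x = <ZZ> and y = <XX>.  If q_i / 2 are the probabilities of
    the four Bell states, then x and y are linear in the q_i, and
      1 + (q_0 - 1)^2 - x^2 - y^2 = 2 q_1 q_2 + q_2 q_3 + q_0 q_3 + q_1 q_3,
    so the bound follows from [C >= q_i - 1] (the fully entangled fraction is at
    most (1 + C) / 2), and equality forces x = +-1 or y = +-1.  A state with
    <A (x) B> = 1 lives, up to local unitaries, on span(|00>, |11>): this is Q.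

    The bound on the fraction comes from a Takagi factorisation of
    sqrt(rho) (Y (x) Y) sqrt(rho)^T, whose singular values are the Wootters
    numbers: it yields four vectors with [w_j . w_k = lambda_k delta_jk] in the
    magic basis; phases and a Hadamard mixing give all four the same value
    w . w, of total modulus at most C, while |w . w| >= |w_i|^2 - sum_{j <> i} |w_j|^2. *)

Set Implicit Arguments.
Unset Strict Implicit.
Unset Printing Implicit Defensive.
Local Open Scope sesquilinear_scope.
Local Notation cj A := (map_mx Num.conj A).

(** * Takagi factorisation *)

Section Takagi.
Variable C : numClosedFieldType.

(** Gram-Schmidt on [u] padded with zero rows. The first row it returns satisfies [u = a *: row],
    with [a >= 0] by the phase convention of [schmidt] and [|a| = 1] by the norms, so [a = 1]. *)
Lemma unitary_completion n (u : 'rV[C]_(1 + n)) :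
  u *m u ^t* = 1%:M ->
  exists2 V : 'M[C]_(1 + n), V \is unitarymx & usubmx V = u.
Proof.
move=> uu1; pose A : 'M[C]_(1 + n) := col_mx u 0; pose V := schmidt A.
have Vu : V \is unitarymx by apply: schmidt_unitarymx.
exists V => //.
have rA : row (lshift n ord0) A = u by rewrite /A rowKu row_id.
have rV : row (lshift n ord0) V = usubmx V by rewrite -row_usubmx row_id.
have := row_schmidt_sub A (lshift n ord0); rewrite rA.
rewrite (bigD1 (lshift n ord0)) //= big1 ?addsmx0; last first.
  move=> i /andP[le0 ne0]; case/eqP: ne0; apply: val_inj => /=.
  by move: le0; rewrite leqn0 => /eqP.
rewrite genmxE -/V rV => /sub_rVP[a ua].
have := form1_row_schmidt A (lshift n ord0); rewrite rA -/V rV dotmxE ua => age0.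
have VV : usubmx V *m (usubmx V) ^t* = 1%:M.
  have /row_unitarymxP/(_ (lshift n ord0) (lshift n ord0)) := Vu.
  rewrite rV dotmxE eqxx => h; apply/matrixP => i j; rewrite !ord1 h.
  by rewrite mxE eqxx.
move: age0; rewrite -scalemxAl VV mxE mxE eqxx mulr1 => age0.
move: uu1; rewrite ua -scalemxAl linearZ map_mxZ -scalemxAr VV.
move=> /matrixP/(_ 0 0); rewrite !mxE eqxx !mulr1n !mulr1 -normCK => /eqP.
rewrite sqrp_eq1 ?normr_ge0 // ger0_norm // => /eqP ->.
by rewrite scale1r.
Qed.

Lemma rV_sqnorm_ge0 n (v : 'rV[C]_n) : 0 <= (v *m v ^t*) 0 0.
Proof.
by rewrite mxE sumr_ge0 // => k _; rewrite !mxE mul_conjC_ge0.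
Qed.

Lemma rV_sqnorm_eq0 n (v : 'rV[C]_n) : ((v *m v ^t*) 0 0 == 0) = (v == 0).
Proof.
apply/idP/eqP => [|->]; last by rewrite mul0mx mxE.
rewrite mxE psumr_eq0 => [/allP h|k _]; last by rewrite !mxE mul_conjC_ge0.
apply/rowP => k; have := h k (mem_index_enum _).
by rewrite !mxE mul_conjC_eq0 => /eqP.
Qed.

(* For an eigenvector v of K K^t* with eigenvalue s^2, the vector conj(v K) + s v
   works, or 'i v when that sum vanishes. *)
Lemma con_eigenvector n (K : 'M[C]_n.+1) : K^T = K ->
  exists (u : 'rV[C]_n.+1) (s : C),
    [/\ 0 <= s, u *m u ^t* = 1%:M & u *m K = s *: cj u].
Proof.
move=> Ksym.
suff [u [s [s0 un0 uK]]] : exists (u : 'rV[C]_n.+1) (s : C),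
    [/\ 0 <= s, u != 0 & u *m K = s *: cj u].
  pose t := (u *m u ^t*) 0 0.
  have t0 : 0 < t by rewrite lt0r rV_sqnorm_eq0 un0 rV_sqnorm_ge0.
  pose r := (sqrtC t)^-1.
  have r0 : 0 < r by rewrite invr_gt0 sqrtC_gt0.
  have rC : r^* = r by rewrite geC0_conj // ltW.
  exists (r *: u), s; split=> //; last first.
    by rewrite -scalemxAl uK map_mxZ /= rC !scalerA mulrC.
  rewrite linearZ map_mxZ /= rC -scalemxAl -scalemxAr scalerA.
  apply/matrixP => i j; rewrite !ord1 [LHS]mxE -/t /r -invfM -expr2 sqrtCK.
  by rewrite mulVf ?gt_eqF // mxE.
have KJ : (K ^t* = cj K) by rewrite Ksym.
have [l /eigenvalueP[v vK vn0]] := eigenvalue_closed (K *m K ^t*) (ltn0Sn n).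
have l0 : 0 <= l.
  have := rV_sqnorm_ge0 (v *m K); rewrite trmx_mul map_mxM mulmxA -(mulmxA v).
  rewrite vK -scalemxAl mxE pmulr_lge0 //.
  by rewrite lt0r rV_sqnorm_eq0 vn0 rV_sqnorm_ge0.
pose s := sqrtC l.
have s0 : 0 <= s by rewrite sqrtC_ge0.
have sC : s^* = s by rewrite geC0_conj.
have JJ m p (A : 'M[C]_(m, p)) : cj (cj A) = A.
  by apply/matrixP => i j; rewrite !mxE conjCK.
have [u0|un0] := eqVneq (cj (v *m K) + s *: v) 0; last first.
  exists (cj (v *m K) + s *: v), s; split=> //.
  rewrite map_mxD JJ map_mxZ /= sC mulmxDl scalerDr scalerA -expr2 sqrtCK.
  rewrite -scalemxAl addrC; congr (_ + _).
  rewrite -[X in _ *m X]JJ -map_mxM -mulmxA -KJ vK map_mxZ /=.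
  by rewrite geC0_conj.
exists ('i *: v), s; split=> //.
  by rewrite scaler_eq0 negb_or neq0Ci.
have := congr1 (fun A : 'rV[C]_n.+1 => cj A) u0.
rewrite map_mxD JJ map_mxZ /= sC map_mx0 => /eqP; rewrite addr_eq0 => /eqP vKE.
by rewrite -scalemxAl vKE map_mxZ /= conjCi !(scalerN, scaleNr) !scalerA mulrC.
Qed.

(** Deflation: a con-eigenvector, completed to a unitary [V], makes (s, 0) the first row of
    [V *m K *m V^T]. Symmetry clears the first column, and induction treats the remaining block. *)
Lemma takagi n (K : 'M[C]_n) : K^T = K ->
  exists (U : 'M[C]_n) (d : 'rV[C]_n),
    [/\ U \is unitarymx, forall i, 0 <= d 0 i & U *m K *m U^T = diag_mx d].
Proof.
elim: n K => [|n IHn] K Ksym.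
  exists 1%:M, 0; split; first by apply/unitarymxP; rewrite flatmx0 [RHS]flatmx0.
  - by case.
  - by rewrite [LHS]flatmx0 [RHS]flatmx0.
have [u [s [s0 uu uK]]] := con_eigenvector Ksym.
have [V Vu Vu0] := @unitary_completion n u uu.
have VVT : V *m V ^t* = 1%:M by apply/unitarymxP.
(* This is the first row of V V^t* = 1, conjugated. *)
have uVT : cj u *m V^T = row_mx 1%:M 0.
  rewrite -[V in V^T](vsubmxK V) Vu0 tr_col_mx mul_mx_row.
  have := VVT; rewrite -{1 2}(vsubmxK V) Vu0 tr_col_mx map_row_mx mul_col_row.
  rewrite -[n.+1]/(1 + n)%N scalar_mx_block => /eq_block_mx[h1 h2 _ _].
  have J m p (A : 'M[C]_(m, p)) : cj (cj A) = A.
    by apply/matrixP => i j; rewrite !mxE conjCK.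
  by rewrite -[u^T]J -[(dsubmx V)^T]J -!map_mxM h1 h2 map_mx1 map_mx0.
pose L : 'M[C]_(1 + n) := V *m K *m V^T.
have Lsym : L^T = L by rewrite /L !trmx_mul trmxK Ksym mulmxA.
have Lu : usubmx L = row_mx s%:M 0.
  rewrite /L -!mul_usub_mx Vu0 uK -scalemxAl uVT scale_row_mx scaler0.
  by rewrite scale_scalar_mx mulr1.
pose L' : 'M[C]_n := drsubmx L.
have LE : L = block_mx s%:M 0 0 L'.
  have Ldl : dlsubmx L = 0.
    by rewrite -Lsym -trmx_ursub /ursubmx Lu row_mxKr trmx0.
  by rewrite -[LHS](submxK L) Ldl /ulsubmx /ursubmx Lu row_mxKl row_mxKr.
have L'sym : L'^T = L' by rewrite /L' trmx_drsub Lsym.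
have [U [d [Uu d0 UL]]] := IHn _ L'sym.
pose W : 'M[C]_(1 + n) := block_mx 1%:M 0 0 U.
have Wu : W \is unitarymx.
  apply/unitarymxP; rewrite /W.
  rewrite tr_block_mx map_block_mx mulmx_block !trmx0 !map_mx0 trmx1 map_mx1.
  rewrite !(mulmx1, mul1mx, mulmx0, mul0mx, addr0, add0r).
  by rewrite (unitarymxP Uu) -scalar_mx_block.
have WL : W *m L *m W^T = diag_mx (row_mx s%:M d).
  rewrite LE /W tr_block_mx !mulmx_block !trmx0 trmx1.
  rewrite !(mulmx1, mul1mx, mulmx0, mul0mx, addr0, add0r) UL.
  rewrite diag_mx_row; congr block_mx.
  by apply/matrixP => i j; rewrite !ord1 !mxE eqxx.
exists (W *m V : 'M[C]_(1 + n)), (row_mx s%:M d : 'rV[C]_(1 + n)); split.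
- exact: mul_unitarymx.
- move=> i; rewrite mxE; case: splitP => k _; last exact: d0.
  by rewrite ord1 mxE eqxx.
- by rewrite -WL /L trmx_mul !mulmxA.
Qed.

End Takagi.

(** * Spectra of positive square roots *)

Section Spectra.
Variable C : numClosedFieldType.

Lemma prod_XsubC_perm (F : fieldType) n (d e : 'I_n -> F) :
  \prod_i ('X - (d i)%:P) = \prod_i ('X - (e i)%:P) ->
  exists s : 'S_n, forall i, e (s i) = d i.
Proof.
move=> h; have /tuple_permP[s /= hs] : perm_eq [tuple d i | i < n] [tuple e i | i < n].
  by apply: prod_XsubC_eq; rewrite !big_tuple; under eq_bigr do rewrite tnth_mktuple;
     under [RHS]eq_bigr do rewrite tnth_mktuple.
exists s => i.
have := congr1 (fun t => nth (d i) t i) hs.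
rewrite -(tnth_nth (d i) [tuple d i | i < n]).
rewrite -(tnth_nth (d i) [tuple tnth [tuple e i | i < n] (s i) | i < n]).
by rewrite !tnth_mktuple => ->.
Qed.

Lemma unitary_tCmul n (P : 'M[C]_n) : P \is unitarymx -> P ^t* *m P = 1%:M.
Proof. by move=> Pu; apply: mulmx1C; apply/unitarymxP. Qed.

Lemma unitary_tC n (P : 'M[C]_n) : P \is unitarymx -> P ^t* \is unitarymx.
Proof. by rewrite trmxC_unitary. Qed.

Lemma char_poly_unitary n (P A : 'M[C]_n) :
  P \is unitarymx -> char_poly (P *m A *m P ^t*) = char_poly A.
Proof.
move=> Pu; have PP := unitarymxP Pu.
rewrite /char_poly /char_poly_mx.
have -> : 'X%:M - map_mx polyC (P *m A *m P ^t*) =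
   map_mx polyC P *m ('X%:M - map_mx polyC A) *m map_mx polyC (P ^t*).
  rewrite mulmxBr mulmxBl -!map_mxM; congr (_ - _).
  by rewrite scalar_mxC -mulmxA -map_mxM PP map_mx1 mulmx1.
rewrite !det_mulmx mulrAC -det_mulmx -map_mxM PP map_mx1 det1 mul1r.
by [].
Qed.

Lemma char_poly_diag n (d : 'rV[C]_n) :
  char_poly (diag_mx d) = \prod_i ('X - (d 0 i)%:P).
Proof.
rewrite char_poly_trig ?diag_mx_is_trig //.
by apply: eq_bigr => i _; rewrite mxE eqxx mulr1n.
Qed.

Lemma perm_mx_unitary n (s : 'S_n) : perm_mx s \is @unitarymx C n n.
Proof.
apply/unitarymxP; rewrite tr_perm_mx map_perm_mx -perm_mxM fingroup.mulgV.
exact: perm_mx1.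
Qed.

Lemma diag_mx_perm n (s : 'S_n) (d : 'I_n -> C) :
  perm_mx s *m diag_mx (\row_i d i) *m (perm_mx s)^T = diag_mx (\row_i d (s i)).
Proof.
rewrite tr_perm_mx -row_permE -col_permE; apply/matrixP => i j.
by rewrite !mxE (inj_eq perm.perm_inj).
Qed.

Lemma diag_mx_tC n (d : 'rV[C]_n) :
  (forall i, 0 <= d 0 i) -> (diag_mx d) ^t* = diag_mx d.
Proof.
move=> d0; rewrite tr_diag_mx map_diag_mx; congr diag_mx.
by apply/rowP => i; rewrite mxE; exact: geC0_conj.
Qed.

(** The spectral theorem delivers the eigenvalues in an order of its own; the characteristic
    polynomial supplies the permutation to the prescribed order [l], which is absorbed into [P].
    Nonnegativity comes from testing [N] on the rows of the diagonalising unitary. *)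
Lemma psd_diagonalization n (N : 'M[C]_n) (l : 'I_n -> C) :
  N ^t* = N -> (forall v : 'rV[C]_n, 0 <= (v *m N *m v ^t*) 0 0) ->
  char_poly N = \prod_i ('X - (l i)%:P) ->
  (forall i, 0 <= l i) /\
  exists2 P : 'M[C]_n, P \is unitarymx & N = P ^t* *m diag_mx (\row_i l i) *m P.
Proof.
move=> Nh Np Nc; have Nn : N \is normalmx by apply/normalmxP; rewrite Nh.
have /orthomx_spectralP := Nn; set P := spectralmx N; set d := spectral_diag N.
have Pu : P \is unitarymx by apply: spectral_unitarymx.
rewrite invmx_unitary // => NE.
have PNP : P *m N *m P ^t* = diag_mx d.
  by rewrite NE !mulmxA (unitarymxP Pu) mul1mx -mulmxA (unitarymxP Pu) mulmx1.
have d0 i : 0 <= d 0 i.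
  have := Np (row i P); rewrite -row_mul.
  have -> : row i (P *m N) *m (row i P) ^t* =
     \matrix_(_, _) (P *m N *m P ^t*) i i.
    apply/matrixP => a b; rewrite !mxE; apply: eq_bigr => k _.
    by rewrite !mxE.
  by rewrite mxE PNP mxE eqxx mulr1n.
have [s hs] : exists s : 'S_n, forall i, d 0 (s i) = l i.
  apply: prod_XsubC_perm; rewrite -Nc -char_poly_diag -PNP.
  by rewrite char_poly_unitary.
split=> [i|]; first by rewrite -hs.
exists (perm_mx s *m P); first by rewrite mul_unitarymx // perm_mx_unitary.
have -> : \row_i l i = \row_i d 0 (s i) by apply/rowP => i; rewrite !mxE hs.
rewrite -(diag_mx_perm s (fun i => d 0 i)).
have -> : \row_i d 0 i = d by apply/rowP => i; rewrite mxE.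
have ss : (perm_mx s)^T *m perm_mx s = 1%:M :> 'M[C]_n.
  by rewrite tr_perm_mx -perm_mxM fingroup.mulVg perm_mx1.
have sE : (perm_mx s : 'M[C]_n) ^t* = (perm_mx s)^T.
  by rewrite tr_perm_mx map_perm_mx.
rewrite trmx_mul map_mxM sE !mulmxA -(mulmxA (P ^t*)) ss mulmx1.
by rewrite -(mulmxA _ _ (perm_mx s)) ss mulmx1 -NE.
Qed.

(** Identifies the Takagi values of [K] with the eigenvalues of [N]: their squares are the roots of
    one characteristic polynomial, that of K K^t* = N N, and nonnegative numbers are determined by
    their squares. *)
Lemma takagi_sqrt n (K N : 'M[C]_n) (l : 'I_n -> C) :
  K^T = K -> N ^t* = N -> (forall v : 'rV[C]_n, 0 <= (v *m N *m v ^t*) 0 0) ->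
  N *m N = K *m K ^t* -> char_poly N = \prod_i ('X - (l i)%:P) ->
  exists2 U : 'M[C]_n, U \is unitarymx & U *m K *m U^T = diag_mx (\row_i l i).
Proof.
move=> Ks Nh Np NK Nc; have [l0 [P Pu NE]] := psd_diagonalization Nh Np Nc.
have [U [d [Uu d0 UK]]] := takagi Ks.
have UU : U^T *m (U^T) ^t* = 1%:M by apply/unitarymxP; rewrite trmx_unitary.
have UUT : U^T *m cj U = 1%:M by rewrite -[RHS]UU trmxK.
have diag2 (e : 'rV[C]_n) : diag_mx e *m diag_mx e = diag_mx (\row_i e 0 i ^+ 2).
  by rewrite mulmx_diag; congr diag_mx; apply/rowP => i; rewrite !mxE expr2.
have cp1 : char_poly (K *m K ^t*) = \prod_i ('X - (d 0 i ^+ 2)%:P).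
  rewrite -(char_poly_unitary _ Uu).
  have -> : U *m (K *m K ^t*) *m U ^t* =
            (U *m K *m U^T) *m (U *m K *m U^T) ^t*.
    rewrite !trmx_mul !map_mxM trmxK !mulmxA -(mulmxA (U *m K) U^T) UUT mulmx1.
    by [].
  rewrite UK diag_mx_tC // diag2 char_poly_diag.
  by apply: eq_bigr => i _; rewrite mxE.
have cp2 : char_poly (N *m N) = \prod_i ('X - (l i ^+ 2)%:P).
  have -> : N *m N = P ^t* *m diag_mx (\row_i l i ^+ 2) *m P ^t* ^t*.
    rewrite trmxCK NE !mulmxA -(mulmxA _ P) (unitarymxP Pu) mulmx1.
    rewrite -(mulmxA (P ^t*)) diag2; congr (_ *m diag_mx _ *m _).
    by apply/rowP => i; rewrite !mxE.
  rewrite char_poly_unitary ?trmxC_unitary // char_poly_diag.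
  by apply: eq_bigr => i _; rewrite mxE.
have [s hs] : exists s : 'S_n, forall i, d 0 (s i) ^+ 2 = l i ^+ 2.
  apply: (prod_XsubC_perm (d := fun i => l i ^+ 2) (e := fun i => d 0 i ^+ 2)).
  by rewrite -cp2 -cp1 NK.
have {}hs i : d 0 (s i) = l i.
  by apply/eqP; rewrite -(eqrXn2 (n := 2)) // hs.
exists (perm_mx s *m U); first by rewrite mul_unitarymx // perm_mx_unitary.
rewrite trmx_mul !mulmxA -(mulmxA (perm_mx s)) -(mulmxA (perm_mx s)) UK.
have {1}-> : d = \row_i d 0 i by apply/rowP => i; rewrite mxE.
by rewrite diag_mx_perm; congr diag_mx; apply/rowP => i; rewrite !mxE hs.
Qed.

End Spectra.

Local Open Scope complex_scope.
Local Open Scope classical_set_scope.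
Local Open Scope ring_scope.

(** * Local unitaries *)

Section SmallMatrices.

Lemma sum2E (V : nmodType) (F : 'I_2 -> V) : \sum_i F i = F 0 + F 1.
Proof.
rewrite !big_ord_recl big_ord0 addr0; congr (_ + F _); exact: val_inj.
Qed.

Lemma sum3E (V : nmodType) (F : 'I_3 -> V) : \sum_i F i = F 0 + F 1 + F 2.
Proof.
rewrite !big_ord_recl big_ord0 addr0 addrA.
by congr (_ + F _ + F _); exact: val_inj.
Qed.

Lemma sum4E (V : nmodType) (F : 'I_4 -> V) : \sum_i F i = F 0 + F 1 + F 2 + F 3.
Proof.
rewrite !big_ord_recl big_ord0 addr0 !addrA.
by congr (_ + F _ + F _ + F _); exact: val_inj.
Qed.

Lemma ord2P (P : 'I_2 -> Prop) : P 0 -> P 1 -> forall i, P i.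
Proof.
move=> P0 P1 [[|[|//]] hi].
- by have -> : Ordinal hi = 0 by exact: val_inj.
- by have -> : Ordinal hi = 1 by exact: val_inj.
Qed.

Lemma ord3P (P : 'I_3 -> Prop) : P 0 -> P 1 -> P 2 -> forall i, P i.
Proof.
move=> P0 P1 P2 [[|[|[|//]]] hi].
- by have -> : Ordinal hi = 0 by exact: val_inj.
- by have -> : Ordinal hi = 1 by exact: val_inj.
- by have -> : Ordinal hi = 2 by exact: val_inj.
Qed.

Lemma ord4P (P : 'I_4 -> Prop) : P 0 -> P 1 -> P 2 -> P 3 -> forall i, P i.
Proof.
move=> P0 P1 P2 P3 [[|[|[|[|//]]]] hi].
- by have -> : Ordinal hi = 0 by exact: val_inj.
- by have -> : Ordinal hi = 1 by exact: val_inj.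
- by have -> : Ordinal hi = 2 by exact: val_inj.
- by have -> : Ordinal hi = 3 by exact: val_inj.
Qed.

Lemma hiE : ((hi 0 = 0) * (hi 1 = 0) * (hi 2 = 1) * (hi 3 = 1))%type.
Proof. by do !split; apply: val_inj; rewrite /= inordK. Qed.

Lemma loE : ((lo 0 = 0) * (lo 1 = 1) * (lo 2 = 0) * (lo 3 = 1))%type.
Proof. by do !split; apply: val_inj; rewrite /= inordK. Qed.

Lemma sum_hilo (V : nmodType) (F : 'I_2 -> 'I_2 -> V) :
  \sum_k F (hi k) (lo k) = \sum_i \sum_j F i j.
Proof. by rewrite sum4E !sum2E !hiE !loE !addrA. Qed.

Lemma hilo_eq (k k' : 'I_4) : (k == k') = (hi k == hi k') && (lo k == lo k').
Proof. by elim/ord4P: k; elim/ord4P: k'; rewrite ?hiE ?loE. Qed.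

End SmallMatrices.

(** * Kronecker products, the spin flip, and invariance of the concurrence *)

Section Local.
Variable R : realType.
Local Notation C := (R[i]).
Implicit Types A B U V : 'M[C]_2.

Lemma conjCE (z : C) : z^*%C = Num.conj z. Proof. by []. Qed.

Lemma kronM A B A' B' : kron A B *m kron A' B' = kron (A *m A') (B *m B').
Proof.
apply/matrixP => i j; rewrite !mxE.
under eq_bigr do rewrite !mxE.
rewrite (sum_hilo (fun a b => A (hi i) a * B (lo i) b * (A' a (hi j) * B' b (lo j)))).
rewrite big_distrlr /=; apply: eq_bigr => a _; apply: eq_bigr => b _.
by rewrite mulrACA.
Qed.

Lemma kronT A B : (kron A B)^T = kron A^T B^T.
Proof. by apply/matrixP => i j; rewrite !mxE. Qed.

Lemma kronJ A B : cj (kron A B) = kron (cj A) (cj B).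
Proof. by apply/matrixP => i j; rewrite !mxE rmorphM. Qed.

Lemma krontC A B : (kron A B) ^t* = kron (A ^t*) (B ^t*).
Proof. by rewrite kronT kronJ. Qed.

Lemma kron1 : kron 1%:M 1%:M = 1%:M :> 'M[C]_4.
Proof.
apply/matrixP => i j; rewrite !mxE hilo_eq.
by case: eqP; case: eqP; rewrite ?mulr1 ?mulr0.
Qed.

Lemma kronDr A B B' : kron A (B + B') = kron A B + kron A B'.
Proof. by apply/matrixP => i j; rewrite !mxE mulrDr. Qed.

Lemma kronDl A A' B : kron (A + A') B = kron A B + kron A' B.
Proof. by apply/matrixP => i j; rewrite !mxE mulrDl. Qed.

Lemma kronZr c A B : kron A (c *: B) = c *: kron A B.
Proof. by apply/matrixP => i j; rewrite !mxE mulrCA. Qed.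

Lemma kronZl c A B : kron (c *: A) B = c *: kron A B.
Proof. by apply/matrixP => i j; rewrite !mxE mulrA. Qed.

Lemma kron_unitary A B : A \is unitarymx -> B \is unitarymx ->
  kron A B \is unitarymx.
Proof.
by move=> /unitarymxP hA /unitarymxP hB; apply/unitarymxP; rewrite krontC kronM hA hB kron1.
Qed.

Let Y := pauliY R.
Let S := kron Y Y.

(** Up to a scalar [Y] is the alternating form of the plane, which a 2x2 matrix scales by its
    determinant. *)
Lemma pauliY_sim U : U^T *m Y *m U = \det U *: Y.
Proof.
have detU : \det U = U 0 0 * U 1 1 - U 0 1 * U 1 0.
  rewrite (expand_det_row _ 0) sum2E /cofactor !det_mx11 !mxE /= expr0 expr1.
  have -> : lift 0 0 = 1 :> 'I_2 by apply: val_inj.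
  have -> : lift 1 0 = 0 :> 'I_2 by apply: val_inj.
  by rewrite mul1r mulN1r mulrN.
rewrite detU; apply/matrixP; elim/ord2P; elim/ord2P;
  rewrite !mxE !sum2E !mxE !sum2E !mxE /=; ring.
Qed.

Lemma pauliYT : Y^T = - Y.
Proof. by apply/matrixP; elim/ord2P; elim/ord2P; rewrite !mxE /= ?oppr0 ?opprK. Qed.

Lemma pauliYJ : cj Y = - Y.
Proof.
apply/matrixP; elim/ord2P; elim/ord2P; rewrite !mxE /= ?rmorphN /= ?rmorph0 ?oppr0 //;
  by rewrite complexiE conjCi ?opprK.
Qed.

Lemma kronNN A B : kron (- A) (- B) = kron A B.
Proof. by apply/matrixP => i j; rewrite !mxE mulrNN. Qed.

Lemma flipT : S^T = S.
Proof. by rewrite /S kronT pauliYT kronNN. Qed.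

Lemma flipJ : cj S = S.
Proof. by rewrite /S kronJ pauliYJ kronNN. Qed.

Lemma flip_sim U V :
  (kron U V)^T *m S *m kron U V = (\det U * \det V) *: S.
Proof. by rewrite /S kronT !kronM !pauliY_sim kronZl kronZr scalerA. Qed.

Lemma unitary_det_norm n (U : 'M[C]_n) : U \is unitarymx ->
  \det U * Num.conj (\det U) = 1.
Proof.
by move=> /unitarymxP/(congr1 determinant); rewrite det_mulmx det_map_mx det_tr det1.
Qed.

Lemma spin_flipE (rho : 'M[C]_4) : spin_flip rho = S *m cj rho *m S.
Proof. by []. Qed.

(** Moving [W] through [S] costs the phase [t], the product of the determinants, on one side of
    [rho] and its conjugate on the other; these cancel because |t| = 1. *)
Lemma spin_flip_local U V (rho : 'M[C]_4) :
  U \is unitarymx -> V \is unitarymx ->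
  spin_flip (kron U V *m rho *m (kron U V) ^t*) =
  kron U V *m spin_flip rho *m (kron U V) ^t*.
Proof.
move=> Uu Vu; set W := kron U V; have Wu : W \is unitarymx by apply: kron_unitary.
pose t := \det U * \det V.
have tt : t * Num.conj t = 1.
  by rewrite /t rmorphM mulrACA !unitary_det_norm ?mul1r.
have JJ m p (A : 'M[C]_(m, p)) : cj (cj A) = A.
  by apply/matrixP => i j; rewrite !mxE conjCK.
have h1 : W^T *m S = t *: (S *m W ^t*).
  have := flip_sim U V; rewrite -/W -/t => h.
  rewrite -[LHS]mulmx1 -(unitarymxP Wu) mulmxA h -scalemxAl; by [].
have h2 : S *m cj W = Num.conj t *: (W *m S).
  have := congr1 (fun A : 'M[C]_4 => cj A^T) h1.
  rewrite /= trmx_mul trmxK flipT map_mxM flipJ linearZ /= trmx_mul flipT map_mxZ map_mxM.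
  by rewrite flipJ map_trmx trmxK JJ.
rewrite !spin_flipE !map_mxM !mulmxA h2 -!mulmxA.
have -> : cj (cj W^T) *m S = t *: (S *m W ^t*) by rewrite JJ h1.
by rewrite -!scalemxAl -!scalemxAr scalerA mulrC tt scale1r !mulmxA.
Qed.

Lemma psd_unitary (W M : 'M[C]_4) : psd M -> psd (W *m M *m W ^t*).
Proof.
move=> [Mh Mp]; split; first by rewrite !trmx_mul !map_mxM trmxCK Mh mulmxA.
move=> v; have := Mp (v *m W); rewrite trmx_mul map_mxM !mulmxA; exact.
Qed.

Lemma density_unitary (W rho : 'M[C]_4) : W \is unitarymx ->
  density rho -> density (W *m rho *m W ^t*).
Proof.
move=> Wu [rp rt]; split; first exact: psd_unitary.
by rewrite mxtrace_mulC mulmxA unitary_tCmul // mul1mx.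
Qed.

(** Both square roots [M] and [N] are conjugated by [W]; the numbers [l] stay the same since the
    characteristic polynomial does. *)
Lemma concurrence_local U V (rho : 'M[C]_4) (c : R) :
  U \is unitarymx -> V \is unitarymx -> concurrence_is rho c ->
  concurrence_is (kron U V *m rho *m (kron U V) ^t*) c.
Proof.
move=> Uu Vu [M [N [l [[Mp MM] [Np NN] Nc lm cE]]]].
set W := kron U V; have Wu : W \is unitarymx by apply: kron_unitary.
have sq (A B : 'M[C]_4) : W *m A *m W ^t* *m (W *m B *m W ^t*) = W *m (A *m B) *m W ^t*.
  by rewrite !mulmxA -(mulmxA _ (W ^t*) W) unitary_tCmul // mulmx1.
exists (W *m M *m W ^t*), (W *m N *m W ^t*), l; split=> //.
- by split; [exact: psd_unitary | rewrite sq MM].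
- by split; [exact: psd_unitary | rewrite spin_flip_local // -/W !sq NN].
- by rewrite char_poly_unitary.
Qed.

End Local.

(** * The fully entangled fraction *)

Section Fraction.
Variable R : realType.
Local Notation C := (R[i]).

Lemma normc_eq1 (x y : R) : x ^+ 2 + y ^+ 2 = 1 -> `|x +i* y| = 1 :> C.
Proof. by move=> h; rewrite normc_def /= h sqrtr1. Qed.

(** Law of cosines: the real part [x] of [z] is chosen so that |a + b z| = c, and then w = -(a + b
    z) / c. *)
Lemma triangle_phases (a b c : R) :
  0 < a -> 0 < b -> 0 < c -> c <= a + b -> a - b <= c -> b - a <= c ->
  exists z w : C, [/\ `|z| = 1, `|w| = 1 & a%:C + b%:C * z + c%:C * w = 0].
Proof.
move=> a0 b0 c0 h1 h2 h3.
pose x := (c ^+ 2 - a ^+ 2 - b ^+ 2) / (2 * a * b).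
have ab0 : 0 < 2 * a * b by rewrite !mulr_gt0.
have xE : 2 * a * b * x = c ^+ 2 - a ^+ 2 - b ^+ 2.
  by rewrite /x mulrC divfK ?gt_eqF.
have x1 : x ^+ 2 <= 1.
  have xl : x <= 1 by rewrite /x ler_pdivrMr // mul1r; nra.
  have xg : -1 <= x by rewrite /x ler_pdivlMr // mulN1r; nra.
  nra.
pose y := Num.sqrt (1 - x ^+ 2).
have yE : y ^+ 2 = 1 - x ^+ 2 by rewrite sqr_sqrtr // subr_ge0.
exists (x +i* y), (- ((a + b * x) / c) +i* - (b * y / c)); split.
- by apply: normc_eq1; rewrite yE addrC subrK.
- apply: normc_eq1; rewrite !sqrrN !expr_div_n -mulrDl exprMn yE.
  have -> : (a + b * x) ^+ 2 + b ^+ 2 * (1 - x ^+ 2) = c ^+ 2.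
    by have := xE; nra.
  by rewrite divff // sqrf_eq0 gt_eqF.
- apply/eqP; rewrite eq_complex /=; apply/andP; split; apply/eqP;
    by field; rewrite gt_eqF.
Qed.

(* The phases close the polygon with sides l whenever the longest side allows it. *)
Lemma closing_phases (l : 'I_4 -> R) :
  (forall j k : 'I_4, (j <= k)%N -> l k <= l j) -> (forall k, 0 <= l k) ->
  exists u : 'I_4 -> C, (forall k, `|u k| = 1) /\
    `|\sum_k (l k)%:C * u k| <= (Num.max 0 (l 0 - l 1 - l 2 - l 3))%:C.
Proof.
move=> lm l0.
have l01 : l 1 <= l 0 by apply: lm.
have l12 : l 2 <= l 1 by apply: lm.
have l23 : l 3 <= l 2 by apply: lm.
have [l00 l10 l20 l30] := And4 (l0 0) (l0 1) (l0 2) (l0 3).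
(* When the longest side is at least the sum of the others, pointing those three against it leaves
   exactly the difference. *)
have [s0|s0] := lerP 0 (l 0 - l 1 - l 2 - l 3).
  exists (fun k => if k == 0 then 1 else -1); split.
    by move=> k; case: ifP; rewrite ?normrN normr1.
  rewrite sum4E /= mulr1 !mulrN1 -!rmorphB /= ger0_norm ?lexx //.
  by rewrite ler0c.
(* Otherwise the two shortest sides merge into one and a triangle closes. The strict inequality [s0]
   and the ordering make all three sides positive. *)
have [] := @triangle_phases (l 0) (l 1) (l 2 + l 3); try by lra.
move=> z [w [z1 w1 h]].
exists (fun k => if k == 0 then 1 else if k == 1 then z else w); split.
  by move=> k; case: ifP; [rewrite normr1 | case: ifP].
rewrite sum4E /= mulr1 -addrA -mulrDl -rmorphD h normr0.
exact: lexx.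
Qed.

(** The Hadamard gate without its factor 1/sqrt 2, so that all entries of [had4] are signs and
    square to 1. *)
Definition had : 'M[C]_2 := \matrix_(i, j) (if (i == 1) && (j == 1) then -1 else 1).

Lemma had_mul : had *m had ^t* = 2%:M.
Proof.
apply/matrixP; elim/ord2P; elim/ord2P; rewrite !mxE sum2E !mxE /=
  ?rmorphN ?rmorph1; ring.
Qed.

Definition had4 := kron had had.

Lemma had4_mul : had4 *m had4 ^t* = 4%:M.
Proof.
rewrite krontC kronM !had_mul -[2%:M]scalemx1 kronZl kronZr kron1 scalerA.
by rewrite scalemx1; congr (_%:M); ring.
Qed.

Lemma had4_sq j k : had4 j k ^+ 2 = 1.
Proof.
rewrite /had4 !mxE; do 2 case: ifP => _; ring.
Qed.

(** [W] is twice a unitary, so passing from [G] to [W *m G] multiplies [G ^t* *m G] by 4. Because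
    the entries of [had4] are signs, every row of [G'] has the same sum of squares [m], and |m| is
    controlled by [closing_phases]. The triangle inequality in each row, summed over the four rows,
    gives the claim. *)
Lemma gram_fraction (G : 'M[C]_4) (l : 'I_4 -> R) (i0 : 'I_4) :
  (forall j k : 'I_4, (j <= k)%N -> l k <= l j) -> (forall k, 0 <= l k) ->
  G *m G^T = diag_mx (\row_k (l k)%:C) ->
  (G ^t* *m G) i0 i0 - \sum_(i | i != i0) (G ^t* *m G) i i
    <= (Num.max 0 (l 0 - l 1 - l 2 - l 3))%:C.
Proof.
move=> lm l0 GG; have [u [u1 ul]] := closing_phases lm l0.
(* A phase on a row enters the bilinear form [G *m G^T] squared, hence the square root. *)
pose f k : C := sqrtC (u k).
have f2 k : f k ^+ 2 = u k by rewrite sqrtCK.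
have ff k : Num.conj (f k) * f k = 1.
  by rewrite mulrC -normCK -normrX f2 u1.
pose D : 'M[C]_4 := diag_mx (\row_k f k).
have DD : D ^t* *m D = 1%:M.
  rewrite /D tr_diag_mx map_diag_mx mulmx_diag -diag_const_mx; congr diag_mx.
  by apply/rowP => k; rewrite !mxE ff.
pose W := had4 *m D.
have WW : W ^t* *m W = 4%:M.
  have hh : had4 ^t* *m had4 = 4%:M.
    have : (4^-1 *: had4) *m had4 ^t* = 1%:M.
      by rewrite -scalemxAl had4_mul scale_scalar_mx mulVf ?pnatr_eq0.
    move/mulmx1C; rewrite -scalemxAr => /(congr1 (fun X => 4 *: X)).
    by rewrite scalerA divff ?pnatr_eq0 // scale1r scalemx1.
  rewrite /W trmx_mul map_mxM mulmxA -(mulmxA (D ^t*)) hh.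
  by rewrite scalar_mxC -mulmxA DD mulmx1.
pose G' := W *m G.
have GG' i : (G' ^t* *m G') i i = 4 * (G ^t* *m G) i i.
  rewrite /G' trmx_mul map_mxM mulmxA -(mulmxA (G ^t*)) WW scalar_mxC.
  by rewrite -mulmxA mul_scalar_mx mxE.
pose m := \sum_k (l k)%:C * u k.
have dG' j : \sum_i G' j i ^+ 2 = m.
  have -> : \sum_i G' j i ^+ 2 = (G' *m G'^T) j j.
    by rewrite [RHS]mxE; apply: eq_bigr => i _; rewrite [G'^T _ _]mxE expr2.
  have WE k : W j k = had4 j k * f k by rewrite /W mul_mx_diag mxE [X in _ * X]mxE.
  rewrite /G' trmx_mul mulmxA -(mulmxA W) GG mul_mx_diag mxE.
  apply: eq_bigr => k _; rewrite mxE [X in _ * X * _]mxE [X in _ * X]mxE WE.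
  rewrite -f2 -[RHS]mulr1 -(had4_sq j k); ring.
have sumn i : (G' ^t* *m G') i i = \sum_j `|G' j i| ^+ 2.
  by rewrite mxE; apply: eq_bigr => j _; rewrite !mxE normCKC.
have key : 4 * ((G ^t* *m G) i0 i0 - \sum_(i | i != i0) (G ^t* *m G) i i)
    <= 4 * `|m|.
  rewrite mulrBr mulr_sumr -GG'.
  under eq_bigr do rewrite -GG' sumn.
  rewrite sumn exchange_big /= -sumrB.
  have -> : 4 * `|m| = \sum_(j < 4) `|m| by rewrite sumr_const card_ord mulr_natl.
  apply: ler_sum => j _; rewrite lerBlDr -normrX.
  have -> : G' j i0 ^+ 2 = m - \sum_(i | i != i0) G' j i ^+ 2.
    by rewrite -(dG' j) [in RHS](bigD1 i0) //= addrK.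
  apply: le_trans (ler_normB _ _) _; rewrite lerD2l.
  apply: le_trans (ler_norm_sum _ _ _) _.
  by apply: ler_sum => i _; rewrite normrX.
apply: le_trans ul; rewrite -/m.
by move: key; rewrite ler_pM2l ?ltr0n.
Qed.

(* Up to a factor sqrt 2 the columns are the Bell states Phi+, Phi-, Psi+, Psi-,
   with phases that make them fixed by the spin flip. *)
Definition magic : 'M[C]_4 := \matrix_(k, i)
  (if i == 0 then (if (k == 0) || (k == 3) then 'i else 0)
   else if i == 1 then (if k == 0 then 1 else if k == 3 then -1 else 0)
   else if i == 2 then (if (k == 1) || (k == 2) then 1 else 0)
   else (if k == 1 then 'i else if k == 2 then - 'i else 0)).

(** In the magic basis the bilinear form of the spin flip is the plain dot product; the 2 comes from
    the unnormalised columns. *)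
Lemma magic_flip : magic *m magic^T = 2 *: kron (pauliY R) (pauliY R).
Proof.
have ii : 'i%C * 'i%C = -1 :> C by rewrite -expr2 sqr_i.
apply/matrixP; elim/ord4P; elim/ord4P; rewrite !mxE sum4E !mxE ?hiE ?loE /=;
  rewrite ?(mulr0, mul0r, addr0, add0r, mulr1, mulrN, mulNr, ii, opprK) ?mulr1 //;
  ring.
Qed.

Lemma magic_unitary : magic *m magic ^t* = 2%:M.
Proof.
have ii : 'i%C * Num.conj 'i%C = 1 :> C by rewrite complexiE conjCi mulrN mulCii opprK.
apply/matrixP; elim/ord4P; elim/ord4P; rewrite !mxE sum4E !mxE /= ?rmorphN ?rmorph0 ?rmorph1;
  rewrite ?(mulr0, mul0r, addr0, add0r, mulr1, mulrN, mulNr, ii, opprK) //; ring.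
Qed.

(** Twice the probability of a Bell state, the columns of [magic] having squared norm 2. *)
Definition bell (rho : 'M[C]_4) (i : 'I_4) : C := (magic ^t* *m rho *m magic) i i.

Lemma bell_fraction (rho : 'M[C]_4) (c : R) (i : 'I_4) :
  \tr rho = 1 -> concurrence_is rho c -> bell rho i - 1 <= c%:C.
Proof.
move=> tr1 [M [N [l [[[Mh Mp] MM] [[Nh Np] NN] Nc lm ->]]]].
pose S := kron (pauliY R) (pauliY R).
have MJ : cj M = M^T by rewrite -[in LHS]Mh; apply/matrixP=> a b; rewrite !mxE conjCK.
(* [K] is symmetric and, as [cj M = M^T], satisfies K K^t* = M rho~ M: its Takagi values are the
   Wootters numbers. *)
pose K := M *m S *m M^T.
have KT : K^T = K by rewrite /K !trmx_mul trmxK flipT mulmxA.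
have KK : N *m N = K *m K ^t*.
  rewrite NN spin_flipE -/S -MM map_mxM KT /K !map_mxM MJ flipJ -/S.
  have -> : cj M^T = M by [].
  by rewrite !mulmxA.
have [l0' _] := psd_diagonalization Nh Np Nc.
have l0 k : 0 <= l k by rewrite -ler0c.
have [U Uu UK] := takagi_sqrt KT Nh Np KK Nc.
pose G := U *m M *m magic.
have GG : G *m G^T = diag_mx (\row_k (2 * l k)%:C).
  rewrite /G !trmx_mul !mulmxA -(mulmxA _ magic) magic_flip -/S.
  rewrite -scalemxAr -!scalemxAl -(mulmxA U) -(mulmxA U) -/K UK.
  apply/matrixP => a b; rewrite !mxE rmorphM /= rmorph_nat.
  by case: eqP => _; rewrite ?mulr1n ?mulr0n ?mulr0.
have lm2 (j k : 'I_4) : (j <= k)%N -> 2 * l k <= 2 * l j.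
  by move=> jk; rewrite ler_pM2l ?ltr0n ?lm.
have l2 k : 0 <= 2 * l k by rewrite mulr_ge0 ?ler0n.
have := gram_fraction i lm2 l2 GG.
have GC : G ^t* *m G = magic ^t* *m rho *m magic.
  rewrite /G !trmx_mul !map_mxM Mh !mulmxA -(mulmxA _ (U ^t*)) unitary_tCmul //.
  by rewrite mulmx1 -(mulmxA _ M M) MM.
have trG : \sum_i (G ^t* *m G) i i = 2.
  rewrite -[LHS]/(\tr (G ^t* *m G)) GC mxtrace_mulC mulmxA magic_unitary mul_scalar_mx.
  by rewrite mxtraceZ tr1 mulr1.
have -> : \sum_(j | j != i) (G ^t* *m G) j j = 2 - (G ^t* *m G) i i.
  by rewrite -trG [in RHS](bigD1 i) //= addrAC subrr add0r.
rewrite GC -/(bell rho i) => h.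
(* The four Bell values sum to 2, so the difference bounded by [gram_fraction] is
   [2 * (bell rho i - 1)]; the Gram matrix carries the doubled numbers [2 * l k]. *)
have : 2 * (bell rho i - 1) <= 2 * (Num.max 0 (l 0 - l 1 - l 2 - l 3))%:C.
  have -> : 2 * (bell rho i - 1) = bell rho i - (2 - bell rho i) by ring.
  apply: le_trans h _; rewrite -[2 in X in _ <= X](rmorph_nat (real_complex R)) -rmorphM lecR.
  rewrite maxr_pMr ?ler0n // mulr0 !mulrBr; exact: lexx.
by rewrite ler_pM2l ?ltr0n.
Qed.

End Fraction.

(** * Bell probabilities *)

Section Bell.
Variable R : realType.
Local Notation C := (R[i]).
Local Notation X := (pauliX R).
Local Notation Z := (pauliZ R).

Lemma bellE (rho : 'M[C]_4) :
  [/\ bell rho 0 = rho 0 0 + rho 3 3 + rho 0 3 + rho 3 0,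
      bell rho 1 = rho 0 0 + rho 3 3 - rho 0 3 - rho 3 0,
      bell rho 2 = rho 1 1 + rho 2 2 + rho 1 2 + rho 2 1 &
      bell rho 3 = rho 1 1 + rho 2 2 - rho 1 2 - rho 2 1].
Proof.
have ii : Num.conj 'i = - 'i :> C by rewrite conjCi.
have i2 (a : C) : 'i * a * 'i = - a by rewrite mulrAC mulCii mulN1r.
by split; rewrite /bell !mxE sum4E !mxE !sum4E !mxE /= ?rmorphN ?rmorph1 ?rmorph0 /= ?ii
   ?(mulr0, mul0r, addr0, add0r, mul1r, mulr1, mulNr, mulrN, opprK, oppr0)
   ?(mulrDl, mulNr, mulrN, i2); ring.
Qed.

Lemma tr_ZZ (rho : 'M[C]_4) :
  \tr (rho *m kron Z Z) = rho 0 0 - rho 1 1 - rho 2 2 + rho 3 3.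
Proof.
rewrite /mxtrace sum4E !mxE !sum4E !mxE ?hiE ?loE /=; ring.
Qed.

Lemma tr_XX (rho : 'M[C]_4) :
  \tr (rho *m kron X X) = rho 0 3 + rho 1 2 + rho 2 1 + rho 3 0.
Proof.
rewrite /mxtrace sum4E !mxE !sum4E !mxE ?hiE ?loE /=; ring.
Qed.

Lemma bell_ge0 (rho : 'M[C]_4) i : psd rho -> 0 <= bell rho i.
Proof.
move=> [_ rp]; have := rp (row i (magic R ^t*)).
have -> : row i (magic R ^t*) *m rho *m (row i (magic R ^t*)) ^t* =
   \matrix_(_, _) bell rho i.
  rewrite -row_mul; apply/matrixP => a b; rewrite mxE [RHS]mxE /bell [RHS]mxE.
  apply: eq_bigr => k _; congr (_ * _); first by rewrite mxE.
  by rewrite mxE mxE mxE mxE mxE conjCK.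
by rewrite mxE.
Qed.

(** The deficit [1 + (q0 - 1)^2 - s] is a sum of products of nonnegative terms, and equality kills
    [q0 * q3] and [q1 * q2]. Here [q0] stands for whichever Bell value exceeds 1 and [q3] for the
    one with both correlation signs opposite, so that all four cases are instances. *)
Lemma bell_dominant (q0 q1 q2 q3 c : R) :
  0 <= q1 -> 0 <= q2 -> 0 <= q3 -> q0 + q1 + q2 + q3 = 2 ->
  1 < q0 -> q0 - 1 <= c ->
  let s := ((q0 - q3) ^+ 2 + (q1 - q2) ^+ 2) / 2 in
  s <= 1 + c ^+ 2 /\ (s = 1 + c ^+ 2 -> q3 = 0 /\ (q1 = 0 \/ q2 = 0)).
Proof.
move=> h1 h2 h3 sq q01 qc s.
have e : 1 + (q0 - 1) ^+ 2 - s = 2 * (q1 * q2) + q2 * q3 + q0 * q3 + q1 * q3.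
  rewrite /s; have -> : q0 = 2 - q1 - q2 - q3 by lra.
  by field.
have c2 : (q0 - 1) ^+ 2 <= c ^+ 2 by nra.
have [p1 p2 p3 p4] := And4 (mulr_ge0 h1 h2) (mulr_ge0 h2 h3)
  (mulr_ge0 (ltW (lt_trans ltr01 q01)) h3) (mulr_ge0 h1 h3).
split; first by lra.
move=> sc; have q03 : q0 * q3 = 0 by lra.
have q12 : q1 * q2 = 0 by lra.
split; first by nra.
by move/eqP: q12; rewrite mulf_eq0 => /orP[/eqP|/eqP]; [left|right].
Qed.

Lemma bell_simplex (q0 q1 q2 q3 c : R) :
  0 <= q0 -> 0 <= q1 -> 0 <= q2 -> 0 <= q3 -> q0 + q1 + q2 + q3 = 2 ->
  0 <= c -> q0 - 1 <= c -> q1 - 1 <= c -> q2 - 1 <= c -> q3 - 1 <= c ->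
  let x := (q0 + q1 - q2 - q3) / 2 in let y := (q0 - q1 + q2 - q3) / 2 in
  x ^+ 2 + y ^+ 2 <= 1 + c ^+ 2 /\
  (x ^+ 2 + y ^+ 2 = 1 + c ^+ 2 -> x ^+ 2 = 1 \/ y ^+ 2 = 1).
Proof.
move=> h0 h1 h2 h3 sq c0 c1 c2 c3 c4 x y.
have e : x ^+ 2 + y ^+ 2 = ((q0 - q3) ^+ 2 + (q1 - q2) ^+ 2) / 2.
  by rewrite /x /y; field.
have [g0|g0] := ltrP 1 q0.
  have [|i1 i2] := bell_dominant h1 h2 h3 _ g0 c1; first by lra.
  rewrite e; split=> // /i2[z3 [z|z]]; [right|left].
    have -> : y = 1 by rewrite /y; lra.
    by rewrite ?sqrrN expr1n.
  have -> : x = 1 by rewrite /x; lra.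
    by rewrite ?sqrrN expr1n.
have [g3|g3] := ltrP 1 q3.
  have [|i1 i2] := bell_dominant h1 h2 h0 _ g3 c4; first by lra.
  rewrite e -(sqrrN (q0 - q3)) opprB; split=> // /i2[z3 [z|z]]; [left|right].
    have -> : x = -1 by rewrite /x; lra.
    by rewrite ?sqrrN expr1n.
  have -> : y = -1 by rewrite /y; lra.
    by rewrite ?sqrrN expr1n.
have [g1|g1] := ltrP 1 q1.
  have [|i1 i2] := bell_dominant h0 h3 h2 _ g1 c2; first by lra.
  rewrite e [_ + (q1 - q2) ^+ 2]addrC; split=> // /i2[z3 [z|z]]; [right|left].
    have -> : y = -1 by rewrite /y; lra.
    by rewrite ?sqrrN expr1n.
  have -> : x = 1 by rewrite /x; lra.
    by rewrite ?sqrrN expr1n.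
have [g2|g2] := ltrP 1 q2.
  have [|i1 i2] := bell_dominant h0 h3 h1 _ g2 c3; first by lra.
  rewrite e [_ + (q1 - q2) ^+ 2]addrC -(sqrrN (q1 - q2)) opprB.
  split=> // /i2[z3 [z|z]]; [left|right].
    have -> : x = -1 by rewrite /x; lra.
    by rewrite ?sqrrN expr1n.
  have -> : y = 1 by rewrite /y; lra.
    by rewrite ?sqrrN expr1n.
(* No Bell value exceeds 1: both differences lie in [-1, 1], so the sum of squares is at most 1, and
   equality forces both differences to be 1 or -1. *)
have u1 : (q0 - q3) ^+ 2 <= 1 by nra.
have v1 : (q1 - q2) ^+ 2 <= 1 by nra.
have cc : 0 <= c ^+ 2 by nra.
split; first by lra.
rewrite e => eq1; have u2 : (q0 - q3) ^+ 2 = 1 by lra.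
have v2 : (q1 - q2) ^+ 2 = 1 by lra.
move/eqP: u2; rewrite sqrf_eq1 => /orP[/eqP u2|/eqP u2];
move/eqP: v2; rewrite sqrf_eq1 => /orP[/eqP v2|/eqP v2].
- left; have -> : x = 1 by rewrite /x; lra.
    by rewrite ?sqrrN expr1n.
- right; have -> : y = 1 by rewrite /y; lra.
    by rewrite ?sqrrN expr1n.
- right; have -> : y = -1 by rewrite /y; lra.
    by rewrite ?sqrrN expr1n.
- left; have -> : x = -1 by rewrite /x; lra.
    by rewrite ?sqrrN expr1n.
Qed.

Lemma concurrence_ge0 (rho : 'M[C]_4) (c : R) : concurrence_is rho c -> 0 <= c.
Proof. by move=> [M [N [l [_ _ _ _ ->]]]]; rewrite le_max lexx. Qed.

Lemma ZZ_XX_bound (rho : 'M[C]_4) (c : R) :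
  density rho -> concurrence_is rho c ->
  let x := complex.Re (\tr (rho *m kron Z Z)) in
  let y := complex.Re (\tr (rho *m kron X X)) in
  x ^+ 2 + y ^+ 2 <= 1 + c ^+ 2 /\
  (x ^+ 2 + y ^+ 2 = 1 + c ^+ 2 -> x ^+ 2 = 1 \/ y ^+ 2 = 1).
Proof.
move=> [rp rt] rc x y.
pose q i := complex.Re (bell rho i).
have qE i : bell rho i = (q i)%:C.
  by rewrite /q RRe_real // ger0_real // bell_ge0.
have q0 i : 0 <= q i by rewrite -ler0c -qE bell_ge0.
have qc i : q i - 1 <= c by rewrite -lecR rmorphB /= -qE; exact: bell_fraction.
have [b0 b1 b2 b3] := bellE rho.
have sq : q 0 + q 1 + q 2 + q 3 = 2.
  apply: (@complexI R); rewrite !rmorphD /= -!qE b0 b1 b2 b3 rmorph1.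
  have := rt; rewrite /mxtrace sum4E => h.
  transitivity (2 * (rho 0 0 + rho 1 1 + rho 2 2 + rho 3 3)); first by ring.
  by rewrite h; ring.
have xE : x = (q 0 + q 1 - q 2 - q 3) / 2.
  apply: (@mulfI _ 2); first by rewrite pnatr_eq0.
  rewrite mulrCA divff ?pnatr_eq0 // mulr1 /x /q -!raddfD -!raddfB /= mulr_natl -raddfMn /=.
  congr (complex.Re _); rewrite tr_ZZ b0 b1 b2 b3; ring.
have yE : y = (q 0 - q 1 + q 2 - q 3) / 2.
  apply: (@mulfI _ 2); first by rewrite pnatr_eq0.
  rewrite mulrCA divff ?pnatr_eq0 // mulr1 /y /q -!raddfB -!raddfD -!raddfB /= mulr_natl -raddfMn /=.
  congr (complex.Re _); rewrite tr_XX b0 b1 b2 b3; ring.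
rewrite xE yE; apply: bell_simplex => //; exact: concurrence_ge0 rc.
Qed.

End Bell.

(** * Pauli vectors *)

Section Pauli.
Variable R : realType.
Local Notation C := (R[i]).
Local Notation X := (pauliX R).
Local Notation Z := (pauliZ R).
Implicit Types (u v w : 'rV[R]_3) (H U : 'M[C]_2).

Definition dot u v : R := \sum_k u 0 k * v 0 k.

Lemma dotE u v : dot u v = u 0 0 * v 0 0 + u 0 1 * v 0 1 + u 0 2 * v 0 2.
Proof. exact: sum3E. Qed.

Lemma unit3E u : unit3 u <-> dot u u = 1.
Proof.
by rewrite /unit3 /dot; split; under eq_bigr do rewrite -?expr2.
Qed.

Lemma dot_sigmaE v : [/\ dot_sigma v 0 0 = (v 0 2)%:C,
  dot_sigma v 0 1 = v 0 0 -i* v 0 1, dot_sigma v 1 0 = v 0 0 +i* v 0 1 &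
  dot_sigma v 1 1 = - (v 0 2)%:C].
Proof.
split; rewrite /dot_sigma sum3E /pauli /= !mxE /=; apply/eqP;
rewrite eq_complex /=; apply/andP; split; apply/eqP; ring.
Qed.

Lemma mx2P H H' : H 0 0 = H' 0 0 -> H 0 1 = H' 0 1 -> H 1 0 = H' 1 0 ->
  H 1 1 = H' 1 1 -> H = H'.
Proof. by move=> *; apply/matrixP; elim/ord2P; elim/ord2P. Qed.

Lemma dot_sigma_linear (a b : R) v w :
  dot_sigma (a *: v + b *: w) = a%:C *: dot_sigma v + b%:C *: dot_sigma w.
Proof.
rewrite /dot_sigma !scaler_sumr -big_split; apply: eq_bigr => k _ /=.
by rewrite !mxE rmorphD !rmorphM /= scalerDl !scalerA.
Qed.

Lemma dot_sigmaD v w : dot_sigma (v + w) = dot_sigma v + dot_sigma w.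
Proof. by have := dot_sigma_linear 1 1 v w; rewrite !scale1r. Qed.

Lemma dot_sigmaB v w : dot_sigma (v - w) = dot_sigma v - dot_sigma w.
Proof.
by have := dot_sigma_linear 1 (-1) v w; rewrite rmorphN !scaleN1r !scale1r.
Qed.

Lemma dot_sigma_acomm v w :
  dot_sigma v *m dot_sigma w + dot_sigma w *m dot_sigma v = (2 * dot v w)%:C%:M.
Proof.
have [v1 v2 v3 v4] := dot_sigmaE v; have [w1 w2 w3 w4] := dot_sigmaE w.
rewrite dotE; apply: mx2P; rewrite !mxE !sum2E ?v1 ?v2 ?v3 ?v4 ?w1 ?w2 ?w3 ?w4 /=; apply/eqP;
rewrite eq_complex /=; apply/andP; split; apply/eqP; ring.
Qed.

Lemma dot_sigma_sq v : dot_sigma v *m dot_sigma v = (dot v v)%:C%:M.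
Proof.
have [v1 v2 v3 v4] := dot_sigmaE v.
rewrite dotE; apply: mx2P; rewrite !mxE !sum2E ?v1 ?v2 ?v3 ?v4 /=; apply/eqP;
rewrite eq_complex /=; apply/andP; split; apply/eqP; ring.
Qed.

Lemma dot_sigma_herm v : (dot_sigma v) ^t* = dot_sigma v.
Proof.
have [v1 v2 v3 v4] := dot_sigmaE v.
apply: mx2P; rewrite !mxE -conjCE ?v1 ?v2 ?v3 ?v4 /=; apply/eqP;
rewrite eq_complex /= ?oppr0 ?opprK !eqxx //.
Qed.

Lemma dot_sigma_tr v : \tr (dot_sigma v) = 0.
Proof.
have [v1 v2 v3 v4] := dot_sigmaE v.
by rewrite /mxtrace sum2E v1 v4 subrr.
Qed.

Lemma herm_traceless H : H ^t* = H -> \tr H = 0 -> exists v, H = dot_sigma v.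
Proof.
move=> Hh Ht.
pose v : 'rV[R]_3 := \row_k (if k == 0 then complex.Re (H 1 0)
   else if k == 1 then complex.Im (H 1 0) else complex.Re (H 0 0)).
exists v; have [v1 v2 v3 v4] := dot_sigmaE v.
have h00 : H 0 0 = (complex.Re (H 0 0))%:C.
  have := congr1 (fun A : 'M[C]_2 => A 0 0) Hh; rewrite !mxE -conjCE.
  by case: (H 0 0) => a b [] h; congr Complex; lra.
have h01 : H 0 1 = (H 1 0)^*%C.
  by have := congr1 (fun A : 'M[C]_2 => A 0 1) Hh; rewrite !mxE -conjCE.
have h11 : H 1 1 = - H 0 0.
  by apply/eqP; rewrite -addr_eq0 addrC; move: Ht; rewrite /mxtrace sum2E => ->.
apply: mx2P; rewrite ?v1 ?v2 ?v3 ?v4 ?h01 ?h11 !mxE //=.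
- by case: (H 1 0).
- by case: (H 1 0).
- by rewrite h00.
Qed.

(** The rotation of the Bloch sphere induced by [U]: the conjugate is Hermitian and traceless, and
    its square gives the length of [w]. *)
Lemma unitary_dot_sigma U v : U \is unitarymx -> unit3 v ->
  exists2 w, unit3 w & U *m dot_sigma v *m U ^t* = dot_sigma w.
Proof.
move=> Uu /unit3E vu; have [||w hw] := @herm_traceless (U *m dot_sigma v *m U ^t*).
- by rewrite !trmx_mul !map_mxM trmxCK dot_sigma_herm mulmxA.
- by rewrite mxtrace_mulC mulmxA unitary_tCmul // mul1mx dot_sigma_tr.
exists w => //; apply/unit3E; apply: (@complexI R).
have := dot_sigma_sq w; rewrite -hw !mulmxA -(mulmxA _ (U ^t*)) unitary_tCmul // mulmx1.
rewrite -(mulmxA U) dot_sigma_sq vu mulmx1 (unitarymxP Uu).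
by move=> /matrixP/(_ 0 0); rewrite !mxE eqxx !mulr1n => <-.
Qed.

Definition e3 (i : 'I_3) : 'rV[R]_3 := delta_mx 0 i.

Lemma dot_sigma_e3 i : dot_sigma (e3 i) = pauli R i.
Proof.
rewrite /dot_sigma (bigD1 i) //= big1 ?addr0 ?mxE ?eqxx ?scale1r // => k ki.
by rewrite mxE eqxx (negPf ki) scale0r.
Qed.

Lemma ZE : Z = dot_sigma (e3 2). Proof. by rewrite dot_sigma_e3. Qed.
Lemma XE : X = dot_sigma (e3 0). Proof. by rewrite dot_sigma_e3. Qed.

Lemma dot_e3 v i : dot v (e3 i) = v 0 i.
Proof.
rewrite /dot (bigD1 i) //= big1 ?addr0 ?mxE ?eqxx ?mulr1 // => k ki.
by rewrite mxE eqxx (negPf ki) mulr0.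
Qed.

Lemma unit3_e3 i : unit3 (e3 i).
Proof. by apply/unit3E; rewrite dot_e3 mxE !eqxx. Qed.

Lemma pauliX_unitary : X \is unitarymx.
Proof.
apply/unitarymxP; rewrite XE dot_sigma_herm dot_sigma_sq.
by have /unit3E -> := unit3_e3 0.
Qed.

(* The normalised sum of two involutions intertwines them. *)
Lemma align_Z a : unit3 a -> exists2 U, U \is unitarymx & U *m Z *m U ^t* = dot_sigma a.
Proof.
move=> /unit3E au.
(* At the south pole [a + e3 2] vanishes and cannot be normalised; there [X] itself sends [Z] to
   [- Z]. *)
have [e|ne] := eqVneq (a 0 2) (-1).
  have [a0 a1] : a 0 0 = 0 /\ a 0 1 = 0.
    by move: au; rewrite dotE e => h; split; nra.
  exists X; first exact: pauliX_unitary.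
  rewrite XE dot_sigma_herm -XE.
  have [v1 v2 v3 v4] := dot_sigmaE a.
  apply: mx2P; rewrite !mxE !sum2E !mxE !sum2E !mxE /= ?v1 ?v2 ?v3 ?v4 ?a0 ?a1 ?e;
  apply/eqP; rewrite eq_complex /=; apply/andP; split; apply/eqP; ring.
have agt : 0 < 2 * (1 + a 0 2).
  rewrite mulr_gt0 //; move: au; rewrite dotE => h.
  have h2 : a 0 2 ^+ 2 <= 1 by nra.
  have : -1 <= a 0 2 by nra.
  by rewrite le_eqVlt eq_sym (negPf ne) /=; lra.
(* The length of [a + e3 2]. *)
pose s := Num.sqrt (2 * (1 + a 0 2)).
have s0 : s != 0 by rewrite gt_eqF // sqrtr_gt0.
have s2 : s ^+ 2 = 2 * (1 + a 0 2) by rewrite sqr_sqrtr // ltW.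
pose u := s^-1 *: (a + e3 2).
have uu : dot u u = 1.
  have -> : dot u u = (s ^+ 2)^-1 * (dot a a + 2 * a 0 2 + dot (e3 2) (e3 2)).
    by rewrite !dotE /u !mxE /= -exprVn; ring.
  have /unit3E -> := unit3_e3 2.
  rewrite au s2; have -> : 1 + 2 * a 0 2 + 1 = 2 * (1 + a 0 2) by ring.
  by rewrite mulVf // gt_eqF.
exists (dot_sigma u).
  by apply/unitarymxP; rewrite dot_sigma_herm dot_sigma_sq uu.
have key : dot_sigma u *m Z = dot_sigma a *m dot_sigma u.
  have uE : dot_sigma u = s^-1%:C *: (dot_sigma a + Z).
    have := dot_sigma_linear s^-1 s^-1 a (e3 2).
    by rewrite -scalerDr -ZE -scalerDr.
  rewrite uE -scalemxAl -scalemxAr mulmxDl mulmxDr dot_sigma_sq au ZE dot_sigma_sq.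
  by have /unit3E -> := unit3_e3 2; rewrite addrC.
by rewrite key dot_sigma_herm -mulmxA dot_sigma_sq uu mulmx1.
Qed.

(** Once [Z] is aligned with [a], the pullback [h] of [a'] lies on the equator. A diagonal phase
    gate [D] fixes [Z] and turns [X] into the direction [h]. *)
Lemma align_ZX a a' : unit3 a -> unit3 a' -> dot a a' = 0 ->
  exists U, [/\ U \is unitarymx, U *m Z *m U ^t* = dot_sigma a &
                U *m X *m U ^t* = dot_sigma a'].
Proof.
move=> au a'u aa'; have [U Uu UZ] := align_Z au.
have UU := unitary_tCmul Uu.
have UCu : U ^t* \is unitarymx by rewrite trmxC_unitary.
have [h /unit3E hu hE] := unitary_dot_sigma UCu a'u; rewrite trmxCK in hE.
(* The dot product is read from the anticommutator, which conjugation preserves. *)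
have h2 : h 0 2 = 0.
  have := dot_sigma_acomm h (e3 2); rewrite dot_e3 -ZE -hE.
  have -> : Z = U ^t* *m dot_sigma a *m U.
    by rewrite -UZ !mulmxA UU mul1mx -mulmxA UU mulmx1.
  have cjg (A B : 'M[C]_2) : U ^t* *m A *m U *m (U ^t* *m B *m U) = U ^t* *m (A *m B) *m U.
    by rewrite !mulmxA -(mulmxA _ U (U ^t*)) (unitarymxP Uu) mulmx1.
  rewrite !cjg -mulmxDl -mulmxDr addrC dot_sigma_acomm aa' mulr0.
  rewrite raddf0 mulmx0 mul0mx => /matrixP/(_ 0 0); rewrite !mxE eqxx mulr1n.
  by move=> h0; have := @complexI R _ 0 (esym h0); lra.
pose z : C := h 0 0 +i* h 0 1.
have zz : z * Num.conj z = 1.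
  rewrite -conjCE; apply/eqP; rewrite eq_complex /=.
  by move: hu; rewrite dotE h2 => hu; apply/andP; split; apply/eqP; lra.
pose D : 'M[C]_2 := diag_mx (\row_k if k == 0 then 1 else z).
have DE : [/\ D 0 0 = 1, D 0 1 = 0, D 1 0 = 0 & D 1 1 = z].
  by split; rewrite !mxE.
have [d1 d2 d3 d4] := DE.
have Du : D \is unitarymx.
  apply/unitarymxP; apply: mx2P; rewrite !mxE !sum2E !mxE /= ?rmorph0 ?rmorph1;
  by rewrite ?(mulr0, mul0r, addr0, add0r, mulr1, zz).
have DZ : D *m Z *m D ^t* = Z.
  apply: mx2P; rewrite !mxE !sum2E !mxE !sum2E !mxE /= ?mulr1n ?mulr0n ?rmorph0 ?rmorph1;
  by rewrite ?(mulr0, mul0r, addr0, add0r, mulr1, mulrN, mulNr, zz).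
have DX : D *m X *m D ^t* = dot_sigma h.
  have [v1 v2 v3 v4] := dot_sigmaE h.
  apply: mx2P; rewrite ?v1 ?v2 ?v3 ?v4 !mxE !sum2E !mxE !sum2E !mxE /= ?mulr1n ?mulr0n ?rmorph0 ?rmorph1;
  by rewrite ?(mulr0, mul0r, addr0, add0r, mulr1, mul1r, h2, oppr0).
exists (U *m D); split; first exact: mul_unitarymx.
- by rewrite trmx_mul map_mxM !mulmxA -2!(mulmxA U) DZ.
- rewrite trmx_mul map_mxM !mulmxA -2!(mulmxA U) DX -hE !mulmxA (unitarymxP Uu) mul1mx.
  by rewrite -mulmxA (unitarymxP Uu) mulmx1.
Qed.

End Pauli.

(** * The CHSH bound *)

Section Correlation.
Variable R : realType.
Local Notation C := (R[i]).
Local Notation X := (pauliX R).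
Local Notation Z := (pauliZ R).
Implicit Types (a b c u v w : 'rV[R]_3) (rho : 'M[C]_4).

Definition corr rho u v : R := complex.Re (\tr (rho *m kron (dot_sigma u) (dot_sigma v))).

Lemma ReZ (x : R) (z : C) : complex.Re (x%:C * z) = x * complex.Re z.
Proof. by case: z => p q /=; rewrite mul0r subr0. Qed.

Lemma corr_linear_r rho u (x y : R) v w :
  corr rho u (x *: v + y *: w) = x * corr rho u v + y * corr rho u w.
Proof.
rewrite /corr dot_sigma_linear kronDr !kronZr mulmxDr -!scalemxAr mxtraceD !mxtraceZ.
by rewrite raddfD /= !ReZ.
Qed.

Lemma corr_linear_l rho u (x y : R) v w :
  corr rho (x *: v + y *: w) u = x * corr rho v u + y * corr rho w u.
Proof.
rewrite /corr dot_sigma_linear kronDl !kronZl mulmxDr -!scalemxAr mxtraceD !mxtraceZ.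
by rewrite raddfD /= !ReZ.
Qed.

Lemma corrZr rho u (x : R) v : corr rho u (x *: v) = x * corr rho u v.
Proof. by have := corr_linear_r rho u x 0 v 0; rewrite scaler0 addr0 mul0r addr0. Qed.

Definition corr_vec rho v : 'rV[R]_3 := \row_j corr rho (e3 R j) v.

(** The factor 1 gives both levels the shape [x *: v + y *: w] of the linearity lemmas. *)
Lemma rowE3 u : u = 1 *: (u 0 0 *: e3 R 0 + u 0 1 *: e3 R 1) + u 0 2 *: e3 R 2.
Proof. by apply/rowP; elim/ord3P; rewrite !mxE /=; ring. Qed.

Lemma corrE rho u v : corr rho u v = dot u (corr_vec rho v).
Proof. by rewrite {1}(rowE3 u) !corr_linear_l mul1r dotE !mxE. Qed.

Lemma corr_vec_linear rho (x y : R) v w :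
  corr_vec rho (x *: v + y *: w) = x *: corr_vec rho v + y *: corr_vec rho w.
Proof. by apply/rowP => j; rewrite !mxE corr_linear_r. Qed.

Lemma chsh_corr rho a a' b b' : complex.Re (\tr (rho *m chsh a a' b b')) =
  corr rho a (b + b') + corr rho a' (b - b').
Proof. by rewrite /corr -raddfD /= -mxtraceD -mulmxDr /chsh dot_sigmaD dot_sigmaB. Qed.

Lemma kron_conj_tr (rho : 'M[C]_4) (U V A B : 'M[C]_2) :
  \tr ((kron U V) ^t* *m rho *m kron U V *m kron A B) =
  \tr (rho *m kron (U *m A *m U ^t*) (V *m B *m V ^t*)).
Proof.
rewrite -!mulmxA mxtrace_mulC -mulmxA.
by rewrite krontC !kronM !mulmxA.
Qed.

(** Local unitaries carry both orthonormal pairs to the z and x axes, which reduces the claim to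
    [ZZ_XX_bound] for a state of the same concurrence. *)
Lemma corr_pair rho (t : R) a a' c c' :
  density rho -> concurrence_is rho t ->
  unit3 a -> unit3 a' -> dot a a' = 0 -> unit3 c -> unit3 c' -> dot c c' = 0 ->
  corr rho a c ^+ 2 + corr rho a' c' ^+ 2 <= 1 + t ^+ 2 /\
  (corr rho a c ^+ 2 + corr rho a' c' ^+ 2 = 1 + t ^+ 2 ->
   corr rho a c ^+ 2 = 1 \/ corr rho a' c' ^+ 2 = 1).
Proof.
move=> rd rc au a'u aa cu c'u cc.
have [U [Uu UZ UX]] := align_ZX au a'u aa.
have [V [Vu VZ VX]] := align_ZX cu c'u cc.
have U'u := unitary_tC Uu; have V'u := unitary_tC Vu.
pose r := kron (U ^t*) (V ^t*) *m rho *m (kron (U ^t*) (V ^t*)) ^t*.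
have rE : r = (kron U V) ^t* *m rho *m kron U V by rewrite /r -krontC trmxCK.
have dr : density r by exact: (density_unitary (kron_unitary U'u V'u) rd).
have cr : concurrence_is r t by exact: (concurrence_local U'u V'u rc).
have := ZZ_XX_bound dr cr; rewrite /= rE !kron_conj_tr UZ UX VZ VX; exact.
Qed.

(** * Euclidean geometry of the measurement directions *)

Lemma dotZl (x : R) u v : dot (x *: u) v = x * dot u v.
Proof. by rewrite !dotE !mxE; ring. Qed.

Lemma dotC u v : dot u v = dot v u.
Proof. by rewrite !dotE; ring. Qed.

Lemma dotZr (x : R) u v : dot u (x *: v) = x * dot u v.
Proof. by rewrite dotC dotZl dotC. Qed.

Lemma dot_ge0 u : 0 <= dot u u.
Proof. by rewrite dotE; nra. Qed.

Lemma dot_eq0 u : dot u u = 0 -> u = 0.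
Proof.
rewrite dotE => h; apply/rowP; elim/ord3P; rewrite !mxE; nra.
Qed.

Lemma dot_CS u v : dot u v ^+ 2 <= dot u u * dot v v.
Proof.
rewrite -subr_ge0.
have -> : dot u u * dot v v - dot u v ^+ 2 =
  (u 0 0 * v 0 1 - u 0 1 * v 0 0) ^+ 2 + (u 0 0 * v 0 2 - u 0 2 * v 0 0) ^+ 2 +
  (u 0 1 * v 0 2 - u 0 2 * v 0 1) ^+ 2 by rewrite !dotE; ring.
by rewrite !addr_ge0 ?sqr_ge0.
Qed.

Definition len u := Num.sqrt (dot u u).

Lemma len_sq u : len u ^+ 2 = dot u u.
Proof. by rewrite sqr_sqrtr ?dot_ge0. Qed.

Lemma len_neq0 u : u != 0 -> len u != 0.
Proof. by apply: contra_neq => h; apply: dot_eq0; rewrite -len_sq h expr0n. Qed.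

Lemma normalizeP u : u != 0 -> unit3 ((len u)^-1 *: u) /\ u = len u *: ((len u)^-1 *: u).
Proof.
move=> un; have l0 := len_neq0 un; split; last by rewrite scalerA divff // scale1r.
by apply/unit3E; rewrite dotZl dotZr -len_sq; field.
Qed.

Lemma ex_orth u : exists2 v, unit3 v & dot u v = 0.
Proof.
pose w : 'rV[R]_3 := \row_k (if k == 0 then - u 0 1 else if k == 1 then u 0 0 else 0).
have uw : dot u w = 0 by rewrite dotE !mxE /=; ring.
have [w0|wn] := eqVneq w 0.
  exists (e3 R 0); first exact: unit3_e3.
  by rewrite dot_e3; have /rowP/(_ 1) := w0; rewrite !mxE.
exists ((len w)^-1 *: w); first by case: (normalizeP wn).
by rewrite dotZr uw mulr0.
Qed.

(** A zero vector receives any unit direction orthogonal to the other one, so the degenerate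
    settings b = b' and b = -b' need no separate treatment. *)
Lemma orth_dirs u v : dot u v = 0 -> exists e f,
  [/\ unit3 e, unit3 f, dot e f = 0, u = len u *: e & v = len v *: f].
Proof.
have len0 : len 0 = 0 by rewrite /len dotE !mxE !mul0r !addr0 sqrtr0.
move=> uv; have [->|un] := eqVneq u 0.
  have [->|vn] := eqVneq v 0.
    have [f fu ef] := ex_orth (e3 R 0).
    by exists (e3 R 0), f; rewrite len0 !scale0r; split=> //; exact: unit3_e3.
  have [fu vE] := normalizeP vn.
  have [e eu fe] := ex_orth ((len v)^-1 *: v).
  by exists e, ((len v)^-1 *: v); rewrite len0 scale0r dotC.
have [eu uE] := normalizeP un.
have [->|vn] := eqVneq v 0.
  have [f fu ef] := ex_orth ((len u)^-1 *: u).
  by exists ((len u)^-1 *: u), f; rewrite len0 scale0r.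
have [fu vE] := normalizeP vn.
exists ((len u)^-1 *: u), ((len v)^-1 *: v); split=> //.
by rewrite dotZl dotZr uv !mulr0.
Qed.

(** Diagonalises a real symmetric 2x2 form with off-diagonal entry [y] and diagonal entries
    differing by [x]: (p, q) is the normalised eigenvector (2 y, x - r), where [r] is the gap
    between the eigenvalues. *)
Lemma half_angle (x y : R) : exists p q : R,
  p ^+ 2 + q ^+ 2 = 1 /\ p * q * x + (p ^+ 2 - q ^+ 2) * y = 0.
Proof.
have [->|y0] := eqVneq y 0; first by exists 1, 0; split; ring.
pose r := Num.sqrt (x ^+ 2 + 4 * y ^+ 2).
have y2 : 0 < y ^+ 2 by rewrite lt0r sqrf_eq0 y0 sqr_ge0.
have x2 : 0 <= x ^+ 2 by rewrite sqr_ge0.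
have r2 : r ^+ 2 = x ^+ 2 + 4 * y ^+ 2 by rewrite sqr_sqrtr //; lra.
have r0 : 0 < r by rewrite sqrtr_gt0; lra.
have xr1 : x < r by nra.
pose n := Num.sqrt (2 * r * (r - x)).
have rx : 0 < 2 * r * (r - x) by rewrite !mulr_gt0 // subr_gt0.
have n2 : n ^+ 2 = 2 * r * (r - x) by rewrite sqr_sqrtr // ltW.
have n0 : n != 0 by rewrite gt_eqF // sqrtr_gt0.
exists (2 * y / n), ((x - r) / n); split.
  rewrite !expr_div_n -mulrDl n2.
  have -> : (2 * y) ^+ 2 + (x - r) ^+ 2 = 2 * r * (r - x) by nra.
  by rewrite divff // gt_eqF.
have -> : 2 * y / n * ((x - r) / n) * x + ((2 * y / n) ^+ 2 - ((x - r) / n) ^+ 2) * y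
  = y / n ^+ 2 * (2 * (x - r) * x + 4 * y ^+ 2 - (x - r) ^+ 2) by field.
have -> : 2 * (x - r) * x + 4 * y ^+ 2 - (x - r) ^+ 2 = 0 by nra.
by rewrite mulr0.
Qed.

Lemma corr_plane rho (t : R) c c' :
  density rho -> concurrence_is rho t -> unit3 c -> unit3 c' -> dot c c' = 0 ->
  let s := dot (corr_vec rho c) (corr_vec rho c) +
           dot (corr_vec rho c') (corr_vec rho c') in
  s <= 1 + t ^+ 2 /\
  (s = 1 + t ^+ 2 -> exists a b, [/\ unit3 a, unit3 b & corr rho a b = 1]).
Proof.
move=> rd rc /unit3E cu /unit3E c'u cc; set v := corr_vec rho c; set v' := corr_vec rho c' => s.
have [p [q [pq1 pq]]] := half_angle (dot v' v' - dot v v) (dot v v').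
pose d := p *: c + q *: c'; pose d' := (- q) *: c + p *: c'.
have dE (x y z w : R) (f g : 'rV[R]_3) : dot (x *: f + y *: g) (z *: f + w *: g) =
   x * z * dot f f + (x * w + y * z) * dot f g + y * w * dot g g.
  by rewrite !dotE !mxE; ring.
have du : unit3 d by apply/unit3E; rewrite dE cu c'u cc -[RHS]pq1; ring.
have d'u : unit3 d' by apply/unit3E; rewrite dE cu c'u cc -[RHS]pq1; ring.
have dd : dot d d' = 0 by rewrite dE cu c'u cc; ring.
set w := corr_vec rho d; set w' := corr_vec rho d'.
have wE : w = p *: v + q *: v' by rewrite /w corr_vec_linear.
have w'E : w' = (- q) *: v + p *: v' by rewrite /w' corr_vec_linear.
have ww : dot w w' = 0 by rewrite wE w'E dE -[RHS]pq; ring.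
have sE : s = dot w w + dot w' w'.
  rewrite wE w'E !dE /s -[LHS]mul1r -[X in X * _]pq1; ring.
have [e [f [eu fu ef we wf]]] := orth_dirs ww.
(* Measured along its own direction [e], the vector [w] contributes its full length. *)
have corr1 : corr rho e d ^+ 2 = dot w w.
  rewrite corrE -/w {1}we dotZr; have /unit3E -> := eu; by rewrite mulr1 len_sq.
have corr2 : corr rho f d' ^+ 2 = dot w' w'.
  rewrite corrE -/w' {1}wf dotZr; have /unit3E -> := fu; by rewrite mulr1 len_sq.
have := corr_pair rd rc eu fu ef du d'u dd; rewrite corr1 corr2 -sE => -[le1 eq1].
split=> // /eq1 H.
suff sgn a b : unit3 a -> unit3 b -> corr rho a b ^+ 2 = 1 ->
    exists a b, [/\ unit3 a, unit3 b & corr rho a b = 1].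
  by case: H; [rewrite -corr1; exact: sgn | rewrite -corr2; exact: sgn].
move=> au bu /eqP; rewrite sqrf_eq1 => /orP[/eqP h|/eqP h]; first by exists a, b.
(* A perfect anticorrelation becomes a perfect correlation when [b] is reversed. *)
exists a, (-1 *: b); split=> //; last by rewrite corrZr h mulrNN mulr1.
by move/unit3E: bu => bu; apply/unit3E; rewrite dotZl dotZr bu; ring.
Qed.

(** The vectors [b + b'] and [b - b'] are orthogonal with squared lengths summing to 4.
    Cauchy-Schwarz is used once against each of [a], [a'] and once for the pair of lengths;
    [corr_plane] bounds what remains. *)
Lemma chsh_bound rho (t : R) a a' b b' :
  density rho -> concurrence_is rho t ->
  unit3 a -> unit3 a' -> unit3 b -> unit3 b' ->
  let x := complex.Re (\tr (rho *m chsh a a' b b')) in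
  x <= 2 * Num.sqrt (1 + t ^+ 2) /\
  (x = 2 * Num.sqrt (1 + t ^+ 2) ->
   exists a b, [/\ unit3 a, unit3 b & corr rho a b = 1]).
Proof.
move=> rd rc /unit3E au /unit3E a'u /unit3E bu /unit3E b'u x.
pose s := b + b'; pose d := b - b'.
have sd : dot s d = 0.
  transitivity (dot b b - dot b' b'); last by rewrite bu b'u subrr.
  by rewrite !dotE !mxE; ring.
have [c [c' [cu c'u cc sE dE]]] := orth_dirs sd.
have l4 : len s ^+ 2 + len d ^+ 2 = 4.
  rewrite !len_sq; transitivity (2 * (dot b b + dot b' b')); last by rewrite bu b'u; ring.
  by rewrite !dotE !mxE; ring.
have [] := corr_plane rd rc cu c'u cc.
set v := corr_vec rho c; set v' := corr_vec rho c' => le1 eq1.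
have xE : x = len s * dot a v + len d * dot a' v'.
  by rewrite /x chsh_corr -/s -/d sE dE !corrZr !corrE -sE -dE.
have h1 := dot_CS a v; rewrite au mul1r in h1.
have h2 := dot_CS a' v'; rewrite a'u mul1r in h2.
have x2 : x ^+ 2 <= 4 * (dot v v + dot v' v').
  rewrite xE -l4; set y := dot a v in h1 *; set y' := dot a' v' in h2 *.
  apply: (@le_trans _ _ ((len s ^+ 2 + len d ^+ 2) * (y ^+ 2 + y' ^+ 2))); last first.
    by rewrite l4 ler_pM2l ?ltr0n // lerD.
  rewrite -subr_ge0.
  have -> : (len s ^+ 2 + len d ^+ 2) * (y ^+ 2 + y' ^+ 2) -
     (len s * y + len d * y') ^+ 2 = (len s * y' - len d * y) ^+ 2 by ring.
  exact: sqr_ge0.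
set r := Num.sqrt (1 + t ^+ 2).
have r0 : 0 <= r by exact: sqrtr_ge0.
have r2 : r ^+ 2 = 1 + t ^+ 2 by rewrite sqr_sqrtr // addr_ge0 ?sqr_ge0.
split.
  rewrite leNgt; apply/negP => xr.
  have : (2 * r) ^+ 2 < x ^+ 2 by rewrite ltr_pXn2r // ?nnegrE ?mulr_ge0 ?ler0n // (le_trans _ (ltW xr)) ?mulr_ge0 ?ler0n.
  rewrite ltNge => /negP; apply; apply: le_trans x2 _.
  by rewrite exprMn r2 -natrX ler_pM2l ?ltr0n.
move=> xr; apply: eq1; apply/eqP; rewrite eq_le le1 /=.
by move: x2; rewrite xr exprMn r2 -natrX ler_pM2l ?ltr0n.
Qed.

End Correlation.

(** * States with a perfect correlation *)

Section Family.
Variable R : realType.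
Local Notation C := (R[i]).
Local Notation Z := (pauliZ R).
Implicit Types (r rho : 'M[C]_4).

Lemma form2E r (x y : C) (i j : 'I_4) : i != j ->
  let v : 'rV[C]_4 := x *: delta_mx 0 i + y *: delta_mx 0 j in
  (v *m r *m v ^t*) 0 0 = x * r i i * Num.conj x + x * r i j * Num.conj y
    + y * r j i * Num.conj x + y * r j j * Num.conj y.
Proof.
move=> ij v.
have vr k : (v *m r) 0 k = x * r i k + y * r j k.
  by rewrite mulmxDl -!scalemxAl -!rowE !mxE.
have vC : v ^t* = Num.conj x *: delta_mx i 0 + Num.conj y *: delta_mx j 0.
  by rewrite linearD !linearZ map_mxD !map_mxZ /= !trmx_delta !map_delta_mx.
have add0 (A B : 'M[C]_1) : (A + B) 0 0 = A 0 0 + B 0 0 by rewrite mxE.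
have sc0 (c : C) (A : 'M[C]_1) : (c *: A) 0 0 = c * A 0 0 by rewrite mxE.
have co0 k (A : 'rV[C]_4) : (col k A) 0 0 = A 0 k by rewrite mxE.
rewrite vC mulmxDr -!scalemxAr -!colE add0 !sc0 !co0 !vr; ring.
Qed.

Lemma psd_diag_ge0 r i : psd r -> 0 <= r i i.
Proof.
move=> [_ rp]; have := rp (delta_mx 0 i).
by rewrite trmx_delta map_delta_mx -rowE -colE !mxE.
Qed.

Lemma psd_herm r i j : psd r -> r j i = Num.conj (r i j).
Proof. by move=> [h _]; rewrite -{1}h !mxE. Qed.

Lemma psd_zero_row r i j : psd r -> r i i = 0 -> r i j = 0.
Proof.
move=> rp ri; have [<-//|ij] := eqVneq i j.
apply/eqP/negP => /negP nz.
have jr : r j j \is Num.real by rewrite ger0_real // psd_diag_ge0.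
have nzC : Num.conj (r i j) != 0 by rewrite fmorph_eq0.
(* With this coefficient each cross term equals [- (r j j + 1)] and the form takes the negative
   value [- (r j j + 2)]. *)
have := rp.2 (- (r j j + 1) / r i j *: delta_mx 0 i + 1 *: delta_mx 0 j).
rewrite form2E // ri (psd_herm i j rp).
rewrite !rmorphM rmorphN rmorphD /= fmorphV rmorph1 (conj_Creal jr).
have -> : - (r j j + 1) / r i j * 0 * (- (r j j + 1) / Num.conj (r i j)) +
  - (r j j + 1) / r i j * r i j * 1 +
  1 * Num.conj (r i j) * (- (r j j + 1) / Num.conj (r i j)) + 1 * r j j * 1 =
  - (r j j + 2) by field; rewrite nz nzC.
rewrite oppr_ge0 => h; have : 0 < r j j + 2 by rewrite ltr_wpDl ?psd_diag_ge0.
by move=> /lt_le_trans/(_ h); rewrite ltxx.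
Qed.

Lemma psd_minor r i j : psd r -> i != j -> `|r i j| ^+ 2 <= r i i * r j j.
Proof.
move=> rp ij.
have jr : r j j \is Num.real by rewrite ger0_real // psd_diag_ge0.
have := psd_diag_ge0 j rp; rewrite le_eqVlt => /orP[/eqP j0|j0].
  rewrite (psd_herm j i rp) psd_zero_row // -?j0 // rmorph0 normr0 expr0n mulr0.
  exact: lexx.
(* On this vector the form equals [r j j] times the 2x2 minor. *)
have := rp.2 (r j j *: delta_mx 0 i + (- r i j) *: delta_mx 0 j).
rewrite form2E // (psd_herm i j rp) rmorphN (conj_Creal jr).
have -> : r j j * r i i * r j j + r j j * r i j * - Num.conj (r i j) +
  - r i j * Num.conj (r i j) * r j j + - r i j * r j j * - Num.conj (r i j) =
  r j j * (r i i * r j j - r i j * Num.conj (r i j)) by ring.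
by rewrite pmulr_rge0 // subr_ge0 normCK.
Qed.

(* The real matrix [[al, m], [m, 1 - al]] on span(|00>, |11>). *)
Definition qubit_pair (al m : R) : 'M[C]_4 := \matrix_(i, j)
  (if i == 0 then (if j == 0 then al%:C else if j == 3 then m%:C else 0)
   else if i == 3 then (if j == 0 then m%:C else if j == 3 then (1 - al)%:C else 0)
   else 0).

(** Exchanging [x] and [y] swaps the populations but keeps the coherence [x * y], so the weight [p]
    affects the diagonal only. *)
Lemma mixtureE (p x y : R) : x ^+ 2 + y ^+ 2 = 1 ->
  p%:C *: proj4 (ket00_11 x y) + (1 - p)%:C *: proj4 (ket00_11 y x) =
  qubit_pair (p * x ^+ 2 + (1 - p) * y ^+ 2) (x * y).
Proof.
move=> xy; have cR (z : R) : Num.conj (z%:C) = z%:C by rewrite -conjCE conjc_real.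
have e3 : 1 - (p * x ^+ 2 + (1 - p) * y ^+ 2) = p * y ^+ 2 + (1 - p) * x ^+ 2.
  have -> : y ^+ 2 = 1 - x ^+ 2 by lra.
  ring.
apply/matrixP; elim/ord4P; elim/ord4P; rewrite !mxE !big_ord1 !mxE /= ?cR ?rmorph0
  ?e3 ?(mulr0, mul0r, addr0) // -?rmorphM -?rmorphD /=; congr (_%:C); ring.
Qed.

(** A coherence cos sin = m allows the populations (1 + k) / 2 and (1 - k) / 2 with k^2 = 1 - 4 m^2.
    Mixing moves [al] between these two values, and the hypothesis on [m ^+ 2] says exactly that
    [al] lies there. *)
Lemma qubit_pair_mixture (al m : R) : 0 <= m -> m ^+ 2 <= al * (1 - al) ->
  exists p theta : R, [/\ 0 <= p <= 1, 0 <= theta < pi &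
    qubit_pair al m = p%:C *: proj4 (ket00_11 (cos theta) (sin theta))
                  + (1 - p)%:C *: proj4 (ket00_11 (sin theta) (cos theta))].
Proof.
move=> m0 mal.
have m2 : 0 <= 1 - 4 * m ^+ 2 by have := sqr_ge0 (2 * al - 1); nra.
pose k := Num.sqrt (1 - 4 * m ^+ 2).
have k2 : k ^+ 2 = 1 - 4 * m ^+ 2 by rewrite sqr_sqrtr.
have k0 : 0 <= k by apply: sqrtr_ge0.
have k1 : k <= 1 by nra.
pose x := Num.sqrt ((1 + k) / 2).
have x0 : 0 <= x by apply: sqrtr_ge0.
have x2 : x ^+ 2 = (1 + k) / 2 by rewrite sqr_sqrtr //; lra.
have x1 : -1 <= x <= 1 by apply/andP; split; nra.
pose theta := acos x.
have cx : cos theta = x by rewrite /theta acosK.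
have sx : sin theta = Num.sqrt (1 - x ^+ 2) by rewrite /theta sin_acos.
have s2 : sin theta ^+ 2 = (1 - k) / 2.
  by rewrite sx sqr_sqrtr x2; lra.
have s0 : 0 <= sin theta by rewrite sx sqrtr_ge0.
have xs : x * sin theta = m.
  apply/eqP; rewrite -(eqrXn2 (n := 2)) ?mulr_ge0 // exprMn x2 s2.
  by apply/eqP; move: k2; nra.
have th : 0 <= theta < pi.
  rewrite /theta acos_ge0 //= lt_neqAle acos_lepi // andbT.
  by apply/negP => /eqP h; move: cx; rewrite /theta h cospi; lra.
have alk : (2 * al - 1) ^+ 2 <= k ^+ 2 by rewrite k2; nra.
have [p p01 pE] : exists2 p, 0 <= p <= 1 & al = (1 - k) / 2 + p * k.
  (* For [k = 0] the interval is the single point 1/2, and the weight 0 serves. *)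
  have [kz|kn] := eqVneq k 0.
    by exists 0; [lra | move: alk; rewrite kz => h; have : 2 * al - 1 = 0; nra].
  have kp : 0 < k by rewrite lt0r kn.
  exists ((al - (1 - k) / 2) / k); last by field.
  rewrite divr_ge0 //=; last by nra.
  by rewrite ler_pdivrMr // mul1r; nra.
exists p, theta; split=> //; rewrite mixtureE ?cos2Dsin2 // cx xs x2 s2.
by congr qubit_pair; rewrite pE; field.
Qed.

(** With [a] and [b] aligned to the z axis, <ZZ> = 1 empties |01> and |10>, and positivity clears
    their rows and columns. A phase gate on the second qubit then makes the surviving coherence real
    and nonnegative. *)
Lemma inQ_corr1 rho a b : density rho -> unit3 a -> unit3 b -> corr rho a b = 1 ->
  inQ rho.
Proof.
move=> rd au bu; have [U Uu UZ] := align_Z au; have [V Vu VZ] := align_Z bu.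
rewrite /corr -UZ -VZ -kron_conj_tr.
set W := kron U V; have Wu : W \is unitarymx := kron_unitary Uu Vu.
have WCu := unitary_tC Wu.
have := density_unitary WCu rd; rewrite trmxCK; set r := _ *m _ *m W.
move=> [rp rt] r1.
have rhoE : rho = W *m r *m W ^t*.
  by rewrite /r !mulmxA (unitarymxP Wu) mul1mx -mulmxA (unitarymxP Wu) mulmx1.
pose q i := complex.Re (r i i).
have qE i : r i i = (q i)%:C.
  by rewrite /q RRe_real // ger0_real // psd_diag_ge0.
have q0 i : 0 <= q i by rewrite -ler0c -qE psd_diag_ge0.
have qs : q 0 + q 1 + q 2 + q 3 = 1.
  by apply: (@complexI R); rewrite !rmorphD rmorph1 /= -!qE -rt /mxtrace sum4E.
have qd : q 0 - q 1 - q 2 + q 3 = 1.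
  by move: r1; rewrite tr_ZZ !qE -!rmorphB -rmorphD.
have [q1 q2] : q 1 = 0 /\ q 2 = 0 by have := q0 1; have := q0 2; split; lra.
have r1j j : r 1 j = 0 by apply: psd_zero_row; rewrite // qE q1.
have r2j j : r 2 j = 0 by apply: psd_zero_row; rewrite // qE q2.
have rj1 j : r j 1 = 0 by rewrite (psd_herm 1 j rp) r1j rmorph0.
have rj2 j : r j 2 = 0 by rewrite (psd_herm 2 j rp) r2j rmorph0.
pose m := complex.Re `|r 0 3|.
have mE : `|r 0 3| = m%:C by rewrite /m RRe_real ?normr_real.
have m0 : 0 <= m by rewrite -ler0c -mE normr_ge0.
have q3 : q 3 = 1 - q 0 by lra.
have mal : m ^+ 2 <= q 0 * (1 - q 0).
  by rewrite -lecR rmorphXn rmorphM /= -mE -q3 -!qE psd_minor.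
(* Polar form of the coherence, with phase 1 when it vanishes. *)
have [w ww zw] : exists2 w : C, w * Num.conj w = 1 & r 0 3 = m%:C * w.
  have [z|nz] := eqVneq (r 0 3) 0.
    by exists 1; [rewrite rmorph1 mulr1 | rewrite -mE z normr0 mul0r].
  have nn : `|r 0 3| != 0 by rewrite normr_eq0.
  exists (r 0 3 / `|r 0 3|); last by rewrite -mE mulrC divfK.
  by rewrite -normCK normrM normfV normr_id divff // expr1n.
pose D : 'M[C]_2 := diag_mx (\row_k if k == 0 then 1 else w).
have Du : D \is unitarymx.
  apply/unitarymxP; apply: mx2P; rewrite !mxE !sum2E !mxE /= ?rmorph0 ?rmorph1;
  by rewrite ?(mulr0, mul0r, addr0, add0r, mulr1, ww).
pose E := kron 1%:M (D ^t*).
have VDu := mul_unitarymx Vu (unitary_tC Du).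
have rE : r = E *m qubit_pair (q 0) m *m E ^t*.
  have wwC : Num.conj w * w = 1 by rewrite mulrC.
  have r30 : r 3 0 = m%:C * Num.conj w.
    by rewrite (psd_herm 0 3 rp) zw rmorphM /= -conjCE conjc_real.
  pose e k : C := if lo k == 0 then 1 else Num.conj w.
  have EE : E = diag_mx (\row_k e k).
    apply/matrixP => i j; rewrite !mxE hilo_eq [hi i == _]eq_sym [lo i == _]eq_sym /e.
    case: (eqVneq (hi j) (hi i)) => _; last by rewrite mul0r.
    case: (eqVneq (lo j) (lo i)) => [->|_]; last by rewrite !mulr0n rmorph0 mulr0.
    by rewrite !mulr1n mul1r; case: ifP; rewrite ?rmorph1.
  have eE i j : (E *m qubit_pair (q 0) m *m E ^t*) i j =
      e i * qubit_pair (q 0) m i j * Num.conj (e j).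
    rewrite EE tr_diag_mx map_diag_mx mul_mx_diag mul_diag_mx.
    rewrite mxE; congr (_ * _); last by rewrite mxE mxE.
    by rewrite mxE; congr (_ * _); rewrite mxE.
  apply/matrixP; elim/ord4P; elim/ord4P; rewrite eE [qubit_pair _ _ _ _]mxE /e ?loE /=
    ?r1j ?r2j ?rj1 ?rj2 ?zw ?r30 ?qE ?q3
    ?rmorph1 ?conjCK ?(mulr0, mul0r, mulr1, mul1r) //.
  - by rewrite mulrC.
  - by rewrite mulrAC wwC mul1r.
have [p [theta [p01 th QE]]] := qubit_pair_mixture m0 mal.
exists U, (V *m D ^t*), p, theta; split; [exact: Uu | exact: VDu | exact: p01 | exact: th |].
rewrite -QE {1}rhoE rE.
have -> : kron U (V *m D ^t*) = W *m E by rewrite /W /E kronM mulmx1.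
by rewrite trmx_mul map_mxM !mulmxA.
Qed.

End Family.

(** * The family Q attains the bound *)

Section Converse.
Variable R : realType.
Local Notation C := (R[i]).
Local Notation X := (pauliX R).
Local Notation Z := (pauliZ R).
Implicit Types (rho : 'M[C]_4).

Lemma spin_flip_qubit_pair (al m : R) :
  spin_flip (qubit_pair al m) = qubit_pair (1 - al) m.
Proof.
have cR (z : R) : Num.conj (z%:C) = z%:C by rewrite -conjCE conjc_real.
have ii : 'i%C * 'i%C = -1 :> C by rewrite -expr2 sqr_i.
have sE i j : kron (pauliY R) (pauliY R) i j =
  if (i == 0) && (j == 3) then -1 else if (i == 1) && (j == 2) then 1
  else if (i == 2) && (j == 1) then 1 else if (i == 3) && (j == 0) then -1 else 0.
  by elim/ord4P: i; elim/ord4P: j; rewrite mxE ?hiE ?loE !mxE /=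
    ?mulrNN ?mulNr ?mulrN ?ii ?opprK ?mulr0 ?mul0r ?oppr0.
have qJ : cj (qubit_pair al m) = qubit_pair al m.
  by apply/matrixP; elim/ord4P; elim/ord4P; rewrite !mxE /= ?cR ?rmorph0.
rewrite spin_flipE qJ; apply/matrixP; elim/ord4P; elim/ord4P.
all: rewrite mxE sum4E !sE /= ?(mulr0, addr0, add0r) [RHS]mxE /= ?mulr1 //.
all: rewrite mxE sum4E !sE /= ?(mul0r, addr0, add0r) [qubit_pair _ _ _ _]mxE /=.
all: by rewrite ?subKr ?mulr0 ?oppr0 ?mulrN1 ?mulN1r ?opprK ?mul1r ?mulr1 ?oppr0.
Qed.

Lemma tr_qubit_pair2 (a b m n : R) :
  \tr (qubit_pair a m *m qubit_pair b n) = (a * b + 2 * (m * n) + (1 - a) * (1 - b))%:C.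
Proof.
rewrite /mxtrace sum4E !mxE !sum4E ![qubit_pair _ _ _ _]mxE /=.
rewrite ?(mulr0, mul0r, addr0, add0r) -!rmorphM -!rmorphD /=; congr (_%:C); ring.
Qed.

Lemma tr_qubit_pair4 (a b m : R) (A := qubit_pair a m *m qubit_pair b m) :
  \tr (A *m A) = ((a * b + m * m) ^+ 2 + 2 * ((a * m + m * (1 - b)) * (m * b + (1 - a) * m))
    + (m * m + (1 - a) * (1 - b)) ^+ 2)%:C.
Proof.
have AE i j : A i j = (if i == 0 then (if j == 0 then a * b + m * m
     else if j == 3 then a * m + m * (1 - b) else 0)
   else if i == 3 then (if j == 0 then m * b + (1 - a) * m
     else if j == 3 then m * m + (1 - a) * (1 - b) else 0) else 0)%:C.
  elim/ord4P: i; elim/ord4P: j; rewrite mxE !sum4E ![qubit_pair _ _ _ _]mxE /=;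
  by rewrite ?(mulr0, mul0r, addr0, add0r) -?rmorphM -?rmorphD.
rewrite /mxtrace sum4E !mxE !sum4E !AE /=.
rewrite ?(mulr0, mul0r, addr0, add0r) -!rmorphM -!rmorphD /=; congr (_%:C); ring.
Qed.

(** The second and fourth power sums of the Wootters numbers are traces of words in [rho] and its
    spin flip, so they can be computed without the square roots. *)
Lemma concurrence_traces rho (c : R) : concurrence_is rho c ->
  exists l : 'I_4 -> R,
  [/\ forall k, 0 <= l k, c = Num.max 0 (l 0 - l 1 - l 2 - l 3),
      \tr (rho *m spin_flip rho) = (\sum_k l k ^+ 2)%:C &
      \tr (rho *m spin_flip rho *m (rho *m spin_flip rho)) = (\sum_k l k ^+ 4)%:C].
Proof.
move=> [M [N [l [[_ MM] [[Nh Np] NN] Nc _ cE]]]].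
have [l0 [P Pu NE]] := psd_diagonalization Nh Np Nc.
pose D e : 'M[C]_4 := diag_mx (\row_k (l k ^+ e)%:C).
have DD e f : D e *m D f = D (e + f)%N.
  rewrite mulmx_diag; congr diag_mx; apply/rowP => k.
  by rewrite !mxE -rmorphM exprD.
have N1 : N = P ^t* *m D 1%N *m P.
  by rewrite {1}NE; congr (_ *m diag_mx _ *m _); apply/rowP => k; rewrite !mxE expr1.
have sq (A B : 'M[C]_4) : P ^t* *m A *m P *m (P ^t* *m B *m P) = P ^t* *m (A *m B) *m P.
  by rewrite !mulmxA -(mulmxA _ P) (unitarymxP Pu) mulmx1.
have trD e : \tr (P ^t* *m D e *m P) = (\sum_k l k ^+ e)%:C.
  rewrite mxtrace_mulC mulmxA (unitarymxP Pu) mul1mx mxtrace_diag rmorph_sum /=.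
  by apply: eq_bigr => k _; rewrite mxE.
have N2 : M *m spin_flip rho *m M = P ^t* *m D 2%N *m P by rewrite -NN N1 sq DD.
exists l; split=> //.
- by move=> k; rewrite -ler0c.
- by rewrite -trD -N2 [in RHS]mxtrace_mulC [in RHS]mulmxA MM.
- rewrite -trD -[4%N]/(2 + 2)%N -DD -sq -N2.
  set F := spin_flip rho; rewrite !mulmxA [in RHS]mxtrace_mulC !mulmxA MM.
  by rewrite -(mulmxA _ M M) MM.
Qed.

(* The power sums are those of the spectrum sqrt k + |z|, sqrt k - |z|, 0, 0. *)
Lemma wootters_two_level (l0 l1 l2 l3 k z : R) :
  0 <= l0 -> 0 <= l1 -> 0 <= l2 -> 0 <= l3 -> z ^+ 2 <= k ->
  l0 ^+ 2 + l1 ^+ 2 + l2 ^+ 2 + l3 ^+ 2 = 2 * (k + z ^+ 2) ->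
  l0 ^+ 4 + l1 ^+ 4 + l2 ^+ 4 + l3 ^+ 4 = 2 * k ^+ 2 + 12 * k * z ^+ 2 + 2 * z ^+ 4 ->
  (Num.max 0 (l0 - l1 - l2 - l3)) ^+ 2 <= 4 * z ^+ 2.
Proof.
move=> p0 p1 p2 p3 zk s2 s4.
have [s0|s0] := lerP 0 (l0 - l1 - l2 - l3); last first.
  by rewrite expr0n mulr_ge0 ?ler0n ?sqr_ge0.
(* The square to be bounded is the sum of squares minus [2 * (l0 * r - P)], so
   [k - z ^+ 2 <= l0 * r - P] suffices. Squares are compared, since [(k - z ^+ 2) ^+ 2] is the
   second elementary symmetric function of the squared numbers. *)
pose r := l1 + l2 + l3; pose P := l1 * l2 + l1 * l3 + l2 * l3.
have r0 : 0 <= r by rewrite /r !addr_ge0.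
have lr : r <= l0 by rewrite /r; lra.
have P0 : 0 <= P by rewrite /P !addr_ge0 ?mulr_ge0.
have rP : P <= r ^+ 2.
  have -> : r ^+ 2 = P + (l1 ^+ 2 + l2 ^+ 2 + l3 ^+ 2 + P) by rewrite /r /P; ring.
  by rewrite lerDl !addr_ge0 ?sqr_ge0 ?mulr_ge0.
have h1 : P <= l0 * r by apply: le_trans rP _; rewrite expr2 ler_wpM2r.
pose e := (l1 * l2) ^+ 2 + (l1 * l3) ^+ 2 + (l2 * l3) ^+ 2.
have eP : e <= P ^+ 2.
  have -> : P ^+ 2 = e + 2 * (l1 * l2 * (l1 * l3) + l1 * l2 * (l2 * l3) + l1 * l3 * (l2 * l3)).
    by rewrite /P /e; ring.
  by rewrite lerDl !(addr_ge0, mulr_ge0).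
have e2 : (k - z ^+ 2) ^+ 2 = l0 ^+ 2 * (l1 ^+ 2 + l2 ^+ 2 + l3 ^+ 2) + e.
  have -> : (k - z ^+ 2) ^+ 2 =
    ((2 * (k + z ^+ 2)) ^+ 2 - (2 * k ^+ 2 + 12 * k * z ^+ 2 + 2 * z ^+ 4)) / 2 by field.
  by rewrite -s2 -s4 /e; field.
have q : (l0 * r - P) ^+ 2 - (k - z ^+ 2) ^+ 2 = 2 * P * (l0 * (l0 - r)) + (P ^+ 2 - e).
  by rewrite e2 /r /P; ring.
have h2 : (k - z ^+ 2) ^+ 2 <= (l0 * r - P) ^+ 2.
  by rewrite -subr_ge0 q addr_ge0 ?subr_ge0 // !mulr_ge0 ?subr_ge0 ?ler0n.
have h3 : k - z ^+ 2 <= l0 * r - P.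
  by rewrite -ler_sqr ?nnegrE ?subr_ge0.
have -> : (l0 - l1 - l2 - l3) ^+ 2 =
  (l0 ^+ 2 + l1 ^+ 2 + l2 ^+ 2 + l3 ^+ 2) - 2 * (l0 * r - P) by rewrite /r /P; ring.
by rewrite s2; lra.
Qed.

(** [wootters_two_level] with [k = al * (1 - al)] and [z = m]. An upper bound on [c] is what
    [inQ_chsh] calls for, since it shows that a CHSH value reaches at least
    [2 * Num.sqrt (1 + c ^+ 2)]. *)
Lemma concurrence_qubit_pair (al m c : R) :
  m ^+ 2 <= al * (1 - al) -> concurrence_is (qubit_pair al m) c ->
  c ^+ 2 <= (2 * m) ^+ 2.
Proof.
move=> mal /concurrence_traces[l [l0 -> ]].
rewrite spin_flip_qubit_pair tr_qubit_pair2 tr_qubit_pair4 !sum4E.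
move=> /(@complexI R) t2 /(@complexI R) t4.
have -> : (2 * m) ^+ 2 = 4 * m ^+ 2 by ring.
apply: (@wootters_two_level _ _ _ _ (al * (1 - al))) => //.
  by rewrite -t2; ring.
by rewrite -t4; ring.
Qed.

(** In the frame of [qubit_pair] one has <ZZ> = 1 and <XX> = 2 m, and suitable settings reach 2
    sqrt(1 + 4 m^2). *)
Lemma inQ_chsh rho (c : R) : inQ rho -> concurrence_is rho c ->
  exists2 x, chsh_values rho x & 2 * Num.sqrt (1 + c ^+ 2) <= x.
Proof.
move=> [U [V [p [theta [Uu Vu /andP[p0 p1] _]]]]]; rewrite mixtureE ?cos2Dsin2 //.
set x := cos theta; set y := sin theta.
have xy : x ^+ 2 + y ^+ 2 = 1 by rewrite cos2Dsin2.
set al := (_ + _); set m := x * y; set W := kron U V => rE rc.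
have Wu : W \is unitarymx := kron_unitary Uu Vu.
have QE : qubit_pair al m = W ^t* *m rho *m W.
  by rewrite rE !mulmxA unitary_tCmul // mul1mx -mulmxA unitary_tCmul // mulmx1.
have mal : m ^+ 2 <= al * (1 - al).
  have -> : al * (1 - al) = m ^+ 2 + p * (1 - p) * (x ^+ 2 - y ^+ 2) ^+ 2.
    rewrite /al /m exprMn; have -> : y ^+ 2 = 1 - x ^+ 2 by lra.
    by ring.
  by rewrite lerDl mulr_ge0 ?sqr_ge0 // mulr_ge0 // subr_ge0.
have cm : c ^+ 2 <= (2 * m) ^+ 2.
  apply: concurrence_qubit_pair mal _; rewrite QE.
  have := concurrence_local (unitary_tC Uu) (unitary_tC Vu) rc.
  by rewrite -krontC trmxCK.
pose g := Num.sqrt (1 + (2 * m) ^+ 2).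
have g2 : g ^+ 2 = 1 + (2 * m) ^+ 2 by rewrite sqr_sqrtr // addr_ge0 ?sqr_ge0.
have g0 : 0 < g by rewrite sqrtr_gt0 ltr_pwDl ?sqr_ge0.
have gn : g != 0 by rewrite gt_eqF.
(* The directions proportional to (2 m, 0, 1) and (-2 m, 0, 1): their sum and difference weight <ZZ>
   and <XX> in the ratio 1 : 2 m, the equality case of Cauchy-Schwarz. *)
pose b := g^-1 *: e3 R 2 + (2 * m / g) *: e3 R 0.
pose b' := g^-1 *: e3 R 2 + (- (2 * m / g)) *: e3 R 0.
have bb : g^-1 ^+ 2 + (2 * m / g) ^+ 2 = 1.
  by rewrite expr_div_n exprVn -[X in X + _]mul1r -mulrDl -g2 divff // sqrf_eq0.
have bu : unit3 b.
  by apply/unit3E; rewrite dotE /b !mxE /= -[RHS]bb; ring.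
have b'u : unit3 b'.
  by apply/unit3E; rewrite dotE /b' !mxE /= -[RHS]bb; ring.
have [a1 a1u a1E] := unitary_dot_sigma Uu (unit3_e3 R 2).
have [a2 a2u a2E] := unitary_dot_sigma Uu (unit3_e3 R 0).
have [b1 b1u b1E] := unitary_dot_sigma Vu bu.
have [b2 b2u b2E] := unitary_dot_sigma Vu b'u.
exists (complex.Re (\tr (rho *m chsh a1 a2 b1 b2))); first by exists a1, a2, b1, b2.
have -> : \tr (rho *m chsh a1 a2 b1 b2) =
          \tr (qubit_pair al m *m chsh (e3 R 2) (e3 R 0) b b').
  rewrite QE /chsh [in LHS]mulmxDr [in RHS]mulmxDr !mxtraceD /W !kron_conj_tr.
  by rewrite mulmxDr mulmxBr mulmxDl mulmxBl a1E a2E b1E b2E.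
rewrite chsh_corr.
have -> : b + b' = (2 / g) *: e3 R 2.
  by apply/rowP => k; rewrite !mxE; field.
have -> : b - b' = (4 * m / g) *: e3 R 0.
  by apply/rowP => k; rewrite !mxE; field.
rewrite !corrZr.
have -> : corr (qubit_pair al m) (e3 R 2) (e3 R 2) = 1.
  rewrite /corr -ZE tr_ZZ !mxE /=; ring.
have -> : corr (qubit_pair al m) (e3 R 0) (e3 R 0) = 2 * m.
  rewrite /corr -XE tr_XX !mxE /=; ring.
have -> : 2 / g * 1 + 4 * m / g * (2 * m) = 2 * g.
  have -> : 2 / g * 1 + 4 * m / g * (2 * m) = 2 * (1 + (2 * m) ^+ 2) / g by field.
  by rewrite -g2; field.
by rewrite ler_pM2l ?ltr0n // ler_wsqrtr // lerD2l.
Qed.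

End Converse.

(** * The maximum is attained *)

Section Attained.
Variable R : realType.
Local Notation C := (R[i]).
Implicit Types (rho : 'M[C]_4).

Local Notation T := ('rV[R]_12).

(** The four settings are packed into one row vector, the setting on which compactness and the
    extreme value theorem are invoked. *)
Definition block3 (o : 'I_4) (v : T) : 'rV[R]_3 := \row_k v 0 (inord (3 * o + k)).

Lemma block3_onto (f : 'I_4 -> 'rV[R]_3) : exists v : T, forall o, block3 o v = f o.
Proof.
exists (\row_(i < 12) f (inord (i %/ 3)) 0 (inord (i %% 3))) => o.
apply/rowP => k; rewrite !mxE inordK; last first.
  by have := ltn_ord o; have := ltn_ord k; lia.
rewrite mulnC divnMDl // modnMDl divn_small // modn_small // addn0.
by rewrite !inord_val.
Qed.

Lemma block3_continuous o k : continuous (fun v : T => block3 o v 0 k).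
Proof.
have -> : (fun v : T => block3 o v 0 k) = (fun v : T => v 0 (inord (3 * o + k))).
  by apply/funext => v; rewrite mxE.
exact: coord_continuous.
Qed.

Lemma continuous_add (f g : T -> R) :
  continuous f -> continuous g -> continuous (fun v => f v + g v).
Proof. by move=> cf cg v; apply: continuousD; [exact: cf | exact: cg]. Qed.

Lemma continuous_mul (f g : T -> R) :
  continuous f -> continuous g -> continuous (fun v => f v * g v).
Proof. by move=> cf cg v; apply: continuousM; [exact: cf | exact: cg]. Qed.

Lemma continuous_dot (f g : T -> 'rV[R]_3) :
  (forall k, continuous (fun v => f v 0 k)) ->
  (forall k, continuous (fun v => g v 0 k)) -> continuous (fun v => dot (f v) (g v)).
Proof.
move=> cf cg; have -> : (fun v => dot (f v) (g v)) =
  (fun v => f v 0 0 * g v 0 0 + f v 0 1 * g v 0 1 + f v 0 2 * g v 0 2).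
  by apply/funext => v; rewrite dotE.
by do !apply: continuous_add; apply: continuous_mul.
Qed.

(** A dot product with a constant vector, from which continuity in [v] is immediate. *)
Lemma corr_vecE rho v j : corr_vec rho v 0 j = dot (\row_k corr rho (e3 R j) (e3 R k)) v.
Proof.
by rewrite mxE {1}(rowE3 v) !corr_linear_r mul1r dotE !mxE; ring.
Qed.

Lemma continuous_corr rho (f g : T -> 'rV[R]_3) :
  (forall k, continuous (fun v => f v 0 k)) ->
  (forall k, continuous (fun v => g v 0 k)) ->
  continuous (fun v => corr rho (f v) (g v)).
Proof.
move=> cf cg; have -> : (fun v => corr rho (f v) (g v)) =
  (fun v => dot (f v) (corr_vec rho (g v))) by apply/funext => v; rewrite corrE.
apply: continuous_dot => // j.
have -> : (fun v => corr_vec rho (g v) 0 j) =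
  (fun v => dot (\row_k corr rho (e3 R j) (e3 R k)) (g v)).
  by apply/funext => v; rewrite corr_vecE.
by apply: continuous_dot => // k; exact: cst_continuous.
Qed.

(** The admissible settings form a closed subset of the cube [-1, 1]^12, hence a compact one, and
    the CHSH value is continuous on it. *)
Lemma chsh_max rho : exists2 x, chsh_values rho x &
  forall y, chsh_values rho y -> y <= x.
Proof.
pose A : set T := [set v | forall o, dot (block3 o v) (block3 o v) = 1].
pose F (v : T) := complex.Re (\tr (rho *m chsh (block3 0 v) (block3 1 v) (block3 2 v) (block3 3 v))).
have A0 : A !=set0.
  have [v vE] := block3_onto (fun=> e3 R 0); exists v => o /=; rewrite vE.
  by apply/unit3E; exact: unit3_e3.
have cF : continuous F.
  have -> : F = (fun v => corr rho (block3 0 v) (block3 2 v + block3 3 v)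
     + corr rho (block3 1 v) (block3 2 v - block3 3 v)).
    by apply/funext => v; rewrite /F chsh_corr.
  apply: continuous_add; apply: continuous_corr => k; try exact: block3_continuous.
    have -> : (fun v : T => (block3 2 v + block3 3 v) 0 k) =
      (fun v => block3 2 v 0 k + block3 3 v 0 k) by apply/funext => v; rewrite mxE.
    by apply: continuous_add; exact: block3_continuous.
  have -> : (fun v : T => (block3 2 v - block3 3 v) 0 k) =
    (fun v => block3 2 v 0 k + (-1) * block3 3 v 0 k).
    by apply/funext => v; rewrite mulN1r mxE; congr (_ + _); rewrite mxE.
  apply: continuous_add; first exact: block3_continuous.
  apply: continuous_mul; first exact: cst_continuous.
  exact: block3_continuous.
have Acl : closed A.
  have -> : A = \bigcap_(o in [set: 'I_4])
      ((fun v : T => dot (block3 o v) (block3 o v)) @^-1` [set x | x = 1]).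
    by apply/seteqP; split => v /= h o; [move=> _; exact: h | exact: (h o I)].
  apply: closed_bigI => o _; apply: closed_comp; last exact: closed_eq.
  move=> v _; apply: continuous_dot => k; exact: block3_continuous.
have Acp : compact A.
  apply: (subclosed_compact Acl (@rV_compact R 12 (fun=> `[-1, 1]%classic) (fun=> @segment_compact R _ _))).
  move=> v /= Av i; rewrite in_itv /=.
  pose o : 'I_4 := inord (i %/ 3); pose k : 'I_3 := inord (i %% 3).
  have iE : v 0 i = block3 o v 0 k.
    rewrite mxE /o /k !inordK ?ltn_mod // ?ltn_divLR // ?ltn_ord //.
    by rewrite mulnC -divn_eq inord_val.
  have h : block3 o v 0 k ^+ 2 <= 1.
    rewrite -(Av o) /dot (bigD1 k) //= -expr2 lerDl sumr_ge0 // => l _.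
    by rewrite -expr2 sqr_ge0.
  by rewrite -ler_norml -(ler_pXn2r (n := 2)) ?nnegrE ?ler01 // expr1n real_normK ?num_real // iE.
have [v vA vmax] := EVT_max_rV A0 Acp (continuous_subspaceT cF).
have {}vA : A v by move: vA; rewrite inE.
exists (F v).
  by exists (block3 0 v), (block3 1 v), (block3 2 v), (block3 3 v); split=> //; apply/unit3E; exact: vA.
move=> y [a [a' [b [b' [/unit3E au /unit3E a'u /unit3E bu /unit3E b'u ->]]]]].
have [w wE] := block3_onto (fun o => if o == 0 then a else if o == 1 then a'
  else if o == 2 then b else b').
have wA : w \in A by rewrite inE => o /=; rewrite wE; elim/ord4P: o.
by have := vmax _ wA; rewrite /F !wE.
Qed.

End Attained.

(** * The bound and its equality case *)

Theorem theorem3 (R : realType) (rho : 'M[R[i]]_4) (c : R) :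
  density rho -> concurrence_is rho c ->
  nonlocality rho <= 2 * Num.sqrt (1 + c ^+ 2) /\
  (nonlocality rho = 2 * Num.sqrt (1 + c ^+ 2) <-> inQ rho).
Proof.
move=> rd rc.
(* Attainment matters: equality for the supremum becomes equality for concrete settings, as the
   equality case of [chsh_bound] requires. *)
have [x xv xmax] := chsh_max rho.
have ub : ubound (chsh_values rho) x by move=> y; exact: xmax.
have NE : nonlocality rho = x.
  apply/eqP; rewrite eq_le ge_sup //; last by exists x.
  by rewrite andTb; apply: ub_le_sup => //; exists x.
rewrite NE; have [a [a' [b [b' [au a'u bu b'u xE]]]]] := xv.
have [le1 eq1] := chsh_bound rd rc au a'u bu b'u; rewrite -xE in le1 eq1.
split=> //; split=> [/eq1[a0 [b0 [a0u b0u h]]]|rQ].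
  exact: inQ_corr1 rd a0u b0u h.
have [y yv ley] := inQ_chsh rQ rc.
by apply/eqP; rewrite eq_le le1 /=; apply: le_trans ley (xmax _ yv).
Qed.
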